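(* There exist a sequence of Hilbert spaces $(H_n)_{n\in\mathbb N}$, bounded operators $A_n\in\mathcal L(H_n)$, $n\in\mathbb N$, and a $C_0$-sequence $\boldsymbol y=(y_n)_{n\in\mathbb N}\in\times_{n\in\mathbb N}H_n$ such that the following holds. (i) $\bigotimes_{n\in\mathbb N}^{\boldsymbol y}A_n=0$ (in the factorwise sense, in particular it is well-defined in that sense). (ii) $\widehat\bigotimes_{n\in\mathbb N}^{\boldsymbol y}A_n$ is not well-defined (in the strong-limit sense). (iii) The complete tensor product $\bigotimes_{n\in\mathbb N}A_n$ is not well-defined.
   Context: Hilbert spaces are complex; $\mathcal L(H)$ denotes the bounded operators on $H$. Products: for $(z_n)\subset\mathbb C$, $\prod_nz_n$ converges unconditionally to $a\in\mathbb C$ if $\lim_{N\to\infty}\prod_{n=1}^Nz_{\sigma(n)}=a$ for every bijection $\sigma:\mathbb N\to\mathbb N$. $\prod_nz_n$ is quasi-convergent if $\prod_n|z_n|$ converges unconditionally to a finite value; its value is then the unconditional limit of $\prod_nz_n$ if it exists and $0$ otherwise. Tensor products of spaces: $(h_n)\in\times_nH_n$ is a $C$-sequence if $\prod_n\|h_n\|$ converges unconditionally to a finite value. For a $C$-sequence $(h_n)$ the elementary tensor $\bigotimes_nh_n$ is the functional $(f_n)\mapsto\prod_n\langle h_n,f_n\rangle$ (quasi-convergent product) on the set of $C$-sequences. The complete tensor product $\bigotimes_nH_n$ is the completion of the linear span of elementary tensors with inner product determined by $\langle\bigotimes_nh_n,\bigotimes_nf_n\rangle=\prod_n\langle h_n,f_n\rangle$.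 A $C$-sequence is a $C_0$-sequence if $\sum_n|1-\|h_n\||<\infty$; two $C_0$-sequences are equivalent if $\sum_n|1-\langle h_n,f_n\rangle|<\infty$ (an equivalence relation). For a $C_0$-sequence $\boldsymbol y$, the incomplete tensor product $\bigotimes_n^{\boldsymbol y}H_n$ is the closed linear span in $\bigotimes_nH_n$ of the $\bigotimes_nh_n$ with $(h_n)$ a $C_0$-sequence equivalent to $\boldsymbol y$. Tensor products of operators $A_n\in\mathcal L(H_n)$: $\bigotimes_nA_n$ (complete) is well-defined if for every elementary tensor $\bigotimes_nh_n$ in $\bigotimes_nH_n$ also $\bigotimes_nA_nh_n$ is an elementary tensor, and $\bigotimes_nh_n\mapsto\bigotimes_nA_nh_n$ extends linearly to a bounded operator on $\bigotimes_nH_n$. $\bigotimes_n^{\boldsymbol y}A_n$ is well-defined in the factorwise sense if for every elementary tensor $\bigotimes_nh_n\in\bigotimes_n^{\boldsymbol y}H_n$, $\bigotimes_nA_nh_n$ is an elementary tensor in $\bigotimes_n^{\boldsymbol y}H_n$, and $\bigotimes_nh_n\mapsto\bigotimes_nA_nh_n$ extends linearly to a bounded operator on $\bigotimes_n^{\boldsymbol y}H_n$. For finite $F\subset\mathbb N$ let $A_F^{(\boldsymbol y)}$ be the operator $(\bigotimes_{n\in F}A_n)\otimes I$ on $\bigotimes_n^{\boldsymbol y}H_n\simeq(\bigotimes_{n\in F}H_n)\otimes(\bigotimes_{n\notin F}^{(y_n)_{n\notin F}}H_n)$. $\widehat\bigotimes_n^{\boldsymbol y}A_n$ is well-defined in the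 strong-limit sense if the net $(A_F^{(\boldsymbol y)})_F$ over finite $F\subset\mathbb N$ ordered by inclusion converges strongly to a bounded operator, which is then denoted $\widehat\bigotimes_n^{\boldsymbol y}A_n$. *)

(* Defs.v *)
From mathcomp Require Import all_boot all_order all_algebra.
From mathcomp Require Import finmap.
From mathcomp Require Import complex.
From mathcomp Require Import all_classical all_reals all_analysis.
From mathcomp Require Import summability.

Set Implicit Arguments.
Unset Strict Implicit.
Unset Printing Implicit Defensive.

Import Order.TTheory GRing.Theory Num.Theory.
Import numFieldNormedType.Exports.

Local Open Scope classical_set_scope.
Local Open Scope ring_scope.

(* Everything is defined over a numClosedFieldType K, so that K carries the
   library's normed-module topology; the intended K is R[i] with R : realType.
   Norms take their values in (the nonnegative reals of) K. *)

(* {dot V for conj}: positive definite Hermitian forms, linear in the first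
   argument and conjugate-linear in the second. *)
Record hilbert (K : numClosedFieldType) := Hilbert {
  hilbert_sort :> completeNormedModType K;
  inner : {dot hilbert_sort for @Num.conj K};
  hilbert_normE : forall x : hilbert_sort, `|x| ^+ 2 = inner x x }.

Definition lin_span (K : numClosedFieldType) (V : lmodType K) (E : set V) :
    set V :=
  [set x | exists n (c : 'I_n -> K) (v : 'I_n -> V),
     (forall i, E (v i)) /\ x = \sum_i c i *: v i].

(* A bounded linear operator on the subspace W; the values of B outside W are
   irrelevant. *)
Definition bounded_operator (K : numClosedFieldType) (V : normedModType K)
    (W : set V) (B : V -> V) : Prop :=
  [/\ forall x, W x -> W (B x),
      forall a x y, W x -> W y -> B (a *: x + y) = a *: B x + B y
    & exists M : K, forall x, W x -> `|B x| <= M * `|x|].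

Section Products.
Variable K : numClosedFieldType.
Implicit Type z : nat -> K.

Definition unconditional_prod z (a : K) : Prop :=
  forall s : nat -> nat, bijective s ->
    \prod_(0 <= n < N) z (s n) @[N --> \oo] --> a.

(* The value of a quasi-convergent product (one for which the product of the
   `|z n| converges unconditionally): the unconditional limit if there is one,
   and 0 otherwise. *)
Definition qprod z : K := xget 0 [set a | unconditional_prod z a].

End Products.

Section TensorProducts.
Variables (K : numClosedFieldType) (H : nat -> hilbert K).
Implicit Types h y : forall n, H n.

Definition C_sequence h : Prop :=
  exists a : K, unconditional_prod (fun n => `|h n|) a.

Definition C_seq := {h : forall n, H n | C_sequence h}.

Definition C0_sequence h : Prop :=
  C_sequence h /\ cvgn (series (fun n => `|1 - `|h n| |)).

Definition C0_equiv h (f : forall n, H n) : Prop :=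
  cvgn (series (fun n => `|1 - inner (H n) (h n) (f n)|)).

(* The functional on C-sequences attached to h; it is only ever used when h is
   itself a C-sequence, and the product is then quasi-convergent. *)
Definition elementary_functional h : C_seq -> K :=
  fun f => qprod (fun n => inner (H n) (h n) (sval f n)).

Definition functional_span : set (C_seq -> K) :=
  lin_span [set elementary_functional (sval h) | h in [set: C_seq]].

(* The complete tensor product is a completion of the span of the elementary
   functionals, i.e. a Hilbert space together with a map that is linear and
   isometric (for the inner product determined by elementary tensors) on the
   span and has dense image. Any two are unitarily isomorphic by a unique
   unitary respecting the maps. The values of the map outside the span are
   irrelevant. *)
Record complete_tensor := CompleteTensor {
  ct_space :> hilbert K;
  ct_emb : (C_seq -> K) -> ct_space;
  ct_emb_linear : forall a phi psi, functional_span phi ->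
    functional_span psi -> ct_emb (a *: phi + psi) = a *: ct_emb phi + ct_emb psi;
  ct_emb_inner : forall h f : C_seq,
    inner ct_space (ct_emb (elementary_functional (sval h)))
                   (ct_emb (elementary_functional (sval f)))
    = qprod (fun n => inner (H n) (sval h n) (sval f n));
  ct_emb_dense : closure (ct_emb @` functional_span) = setT }.

Variable T : complete_tensor.

(* Meaningful for C-sequences only. *)
Definition tensor h : T := ct_emb T (elementary_functional h).

(* C_0-sequences equivalent to y, whose tensors are the elementary tensors
   generating the incomplete tensor product. *)
Definition C0_class y : set (forall n, H n) :=
  [set h | C0_sequence h /\ C0_equiv h y].

Definition incomplete_tensor y : set T :=
  closure (lin_span [set tensor h | h in C0_class y]).

Variable A : forall n, H n -> H n.

(* B is the bounded operator on W extending linearly the map that sends the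
   tensor of h to the tensor of (A n (h n)), for h in E; for each such h,
   (A n (h n)) has to be a C-sequence whose tensor lies in W. *)
Definition tensor_operator (E : set (forall n, H n)) (W : set T)
    (B : T -> T) : Prop :=
  [/\ forall h, E h -> C_sequence (fun n => A (h n)),
      forall h, E h -> W (tensor (fun n => A (h n))),
      bounded_operator W B
    & forall h, E h -> B (tensor h) = tensor (fun n => A (h n))].

Definition complete_well_defined : Prop :=
  exists B, tensor_operator C_sequence setT B.

Definition factorwise_tensor y (B : T -> T) : Prop :=
  tensor_operator (C0_class y) (incomplete_tensor y) B.

(* B is A_F^(y): under the splitting off of the factors in F, the operator
   (tensor of the A n, n in F) tensored with the identity acts on elementary
   tensors as below, and this determines it. *)
Definition partial_operator y (F : {fset nat}) (B : T -> T) : Prop :=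
  bounded_operator (incomplete_tensor y) B /\
  forall h, C0_class y h ->
    B (tensor h) = tensor (fun n => if n \in F then A (h n) else h n).

(* The operators A_F^(y) exist and are unique on the incomplete tensor
   product. Quantifying universally over AF makes the negation of
   strong_limit_well_defined assert in particular that they exist.
   Convergence is along the finite sets F ordered by inclusion. *)
Definition strong_limit y (L : T -> T) : Prop :=
  bounded_operator (incomplete_tensor y) L /\
  forall AF : {fset nat} -> T -> T,
    (forall F, partial_operator y F (AF F)) ->
    forall x, incomplete_tensor y x -> AF F x @[F --> totally] --> L x.

Definition strong_limit_well_defined y : Prop := exists L, strong_limit y L.

End TensorProducts.

Arguments tensor {K H} T h.
Arguments incomplete_tensor {K H} T y.
Arguments tensor_operator {K H} T A E W B.
Arguments complete_well_defined {K H} T A.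
Arguments factorwise_tensor {K H} T A y B.
Arguments partial_operator {K H} T A y F B.
Arguments strong_limit {K H} T A y L.
Arguments strong_limit_well_defined {K H} T A y.

(* Main.v *)
Require Import Defs.
From HB Require Import structures.
From mathcomp Require Import all_boot all_order all_algebra.
From mathcomp Require Import finmap complex.
From mathcomp Require Import all_classical all_reals all_analysis.
From mathcomp Require Import summability.
From mathcomp Require Import ring lra.
Import Order.TTheory GRing.Theory Num.Theory.
Import numFieldNormedType.Exports.
Set Implicit Arguments.
Unset Strict Implicit.
Unset Printing Implicit Defensive.
Local Open Scope classical_set_scope.
Local Open Scope ring_scope.

(** Every space H_n is C^2 with orthonormal basis e_0, e_1, the base sequence
    is y_n = e_0, and every A_n is the operator A that kills e_0 and sends e_1
    to 4 e_1.

    A sequence h equivalent to y has e_1-components tending to 0, so that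
    |A h_n| -> 0 and the product of the |A h_n| converges to 0 under every
    reordering ([amplified_vanishes]).  All the tensors of (A h_n) are then
    zero, and the zero operator is the factorwise tensor product
    ([factorwise_zero]).  On the other hand the constant sequence e_1 is a
    C-sequence, whereas the products of the norms |A e_1| = 4 diverge
    ([complete_tensor_fails]).

    For the strong limit, let t_k be the tensor that has e_1 in the first k
    factors and e_0 in the others.  The t_k are orthonormal, and the operator
    that applies A in the first k factors multiplies t_k by 4^k and maps every
    other t_j to a vector orthogonal to t_k.  Hence it maps
    x = sum_j 2^-j t_j to a vector of norm at least 2^k, and the net of these
    operators does not converge at x ([strong_limit_fails]).  This argument needs the operators on finitely many
    factors to exist ([partial_operator_exists]).  They do because
    A = 2 (1 - U) for the reflection U of e_1: applying U in one factor
    preserves all inner products of elementary tensors, so it extends to an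
    isometry of the incomplete tensor product ([factor_isometry_exists]).

    The complete tensor product itself has to be constructed
    ([complete_tensor_exists]).  Its elementary tensors are the functions
    prod_n <h_n, .> on C-sequences, so it is the reproducing kernel Hilbert
    space of the kernel k(h, f) = prod_n <h_n, f_n>, and the point is that k is
    positive semidefinite ([tensor_fun_psd]).  Finite partial products are
    positive semidefinite, but the quasi-convergent product is 0, not the limit
    of its partial products, when it does not converge unconditionally.  A
    nonzero value of k forces sum_n |1 - <h_n, f_n>| < oo
    ([unconditional_prod_bounded_sums]), and by von Neumann this condition is
    an equivalence relation on the C-sequences whose norms have a nonzero
    product ([similar_trans]).  So k is a limit of finite
    products multiplied by the indicator of an equivalence relation, and such
    kernels are positive semidefinite. *)

(** * Real-valued norms and convergence over the complex numbers *)

(** Unification does not see R[i] as the carrier of a numClosedFieldType, so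
    the generic topology of such fields is copied onto it. *)
#[non_forgetful_inheritance]
HB.instance Definition _ (R : rcfType) :=
  NormedModule.copy R[i] ((R[i] : numClosedFieldType)^o).

Section RealNorm.
Variable R : realType.
Local Notation C := R[i].

Lemma ReM (z w : C) : complex.Re (z * w) =
  complex.Re z * complex.Re w - complex.Im z * complex.Im w.
Proof. by case: z => a b; case: w. Qed.
Lemma ReD (z w : C) : complex.Re (z + w) = complex.Re z + complex.Re w.
Proof. by case: z => a b; case: w. Qed.
Lemma ImD (z w : C) : complex.Im (z + w) = complex.Im z + complex.Im w.
Proof. by case: z => a b; case: w. Qed.
Lemma ReN (z : C) : complex.Re (- z) = - complex.Re z.
Proof. by case: z. Qed.
Lemma ImN (z : C) : complex.Im (- z) = - complex.Im z.
Proof. by case: z. Qed.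
Lemma conjCE (z : C) : Num.conj z = conjc z.
Proof. by []. Qed.

(** The order of R[i] is partial; norms taken in R can be handled by the
    decision procedures for ordered fields. *)
Definition nrm (V : normedZmodType C) (x : V) : R := complex.Re `|x|.

Section NormedZmod.
Variable V : normedZmodType C.
Implicit Types x y : V.

Lemma nrmE x : `|x| = (nrm x)%:C%C.
Proof. by rewrite /nrm RRe_real ?normr_real. Qed.

Lemma nrm_ge0 x : 0 <= nrm x.
Proof. by rewrite -ler0c -nrmE normr_ge0. Qed.

Lemma nrmD x y : nrm (x + y) <= nrm x + nrm y.
Proof. by rewrite -lecR rmorphD /= -!nrmE ler_normD. Qed.

Lemma nrmN x : nrm (- x) = nrm x.
Proof. by rewrite /nrm normrN. Qed.

Lemma nrmC x y : nrm (x - y) = nrm (y - x).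
Proof. by rewrite /nrm distrC. Qed.

Lemma nrm0 : nrm (0 : V) = 0.
Proof. by rewrite /nrm normr0. Qed.

Lemma nrm_eq0 x : nrm x = 0 -> x = 0.
Proof. by move=> nx0; apply/eqP; rewrite -normr_eq0 nrmE nx0. Qed.

Lemma nrm_tri x y z : nrm (x - z) <= nrm (x - y) + nrm (y - z).
Proof. by apply: le_trans (nrmD _ _); rewrite addrA subrK. Qed.

Lemma nrm_sum (I : Type) (s : seq I) (P : pred I) (F : I -> V) :
  nrm (\sum_(i <- s | P i) F i) <= \sum_(i <- s | P i) nrm (F i).
Proof.
elim/big_ind2: _ => [|x a y b xa yb|//]; first by rewrite nrm0.
by apply: le_trans (nrmD _ _) _; exact: lerD.
Qed.

End NormedZmod.

Lemma nrmZ (V : normedModType C) (a : C) (x : V) : nrm (a *: x) = nrm a * nrm x.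
Proof. by apply: (@complexI R); rewrite rmorphM /= -!nrmE normrZ. Qed.

Lemma nrmM (a b : C) : nrm (a * b) = nrm a * nrm b.
Proof. by apply: (@complexI R); rewrite rmorphM /= -!nrmE normrM. Qed.

Lemma nrm1 : nrm (1 : C) = 1.
Proof. by rewrite /nrm normr1. Qed.

Lemma nrm_conj (a : C) : nrm (Num.conj a) = nrm a.
Proof. by rewrite /nrm norm_conjC. Qed.

Lemma nrm_prod (I : Type) (s : seq I) (F : I -> C) :
  nrm (\prod_(i <- s) F i) = \prod_(i <- s) nrm (F i).
Proof. by apply: (big_morph (@nrm C) nrmM nrm1). Qed.

Lemma nrm_real (a : R) : nrm (a%:C%C : C) = `|a|.
Proof.
by rewrite /nrm normc_def /= expr0n addr0 sqrtr_sqr.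
Qed.

Lemma sqr_nrm (z : C) : nrm z ^+ 2 = complex.Re z ^+ 2 + complex.Im z ^+ 2.
Proof. by apply: (@complexI R); rewrite add_Re2_Im2 nrmE rmorphXn. Qed.

Lemma Re_le_nrm (z : C) : `|complex.Re z| <= nrm z.
Proof.
rewrite -ler_sqr ?nnegrE ?nrm_ge0 ?normr_ge0// real_normK ?num_real//.
by rewrite sqr_nrm lerDl sqr_ge0.
Qed.

Lemma Im_le_nrm (z : C) : `|complex.Im z| <= nrm z.
Proof.
rewrite -ler_sqr ?nnegrE ?nrm_ge0 ?normr_ge0// real_normK ?num_real//.
by rewrite sqr_nrm lerDr sqr_ge0.
Qed.

Lemma nrm_le_ReIm (z : C) : nrm z <= `|complex.Re z| + `|complex.Im z|.
Proof.
rewrite -ler_sqr ?nnegrE ?nrm_ge0 ?addr_ge0// sqr_nrm sqrrD.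
rewrite !real_normK ?num_real//.
have : 0 <= `|complex.Re z| * `|complex.Im z| by rewrite mulr_ge0.
rewrite mulr2n; lra.
Qed.

Lemma gt0_complexP (e : C) : 0 < e -> exists2 d : R, 0 < d & e = d%:C%C.
Proof.
move=> e0; have er : e \is Num.real by rewrite realE ltW.
by exists (complex.Re e); [rewrite -ltcR RRe_real|rewrite RRe_real].
Qed.

Lemma inv_succ_lt (e : R) : 0 < e -> exists N, forall n, (N <= n)%N -> n.+1%:R^-1 < e.
Proof.
move=> e0; exists (Num.truncn e^-1) => n Nn.
rewrite -[e]invrK ltf_pV2 ?posrE ?invr_gt0 ?ltr0n//.
by apply: lt_le_trans (truncnS_gt _) _; rewrite ler_nat ltnS.
Qed.

Section Convergence.
Variable V : normedModType C.

Lemma cvg_nrmP (u : nat -> V) (l : V) : u n @[n --> \oo] --> l <->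
  forall e : R, 0 < e -> exists N, forall n, (N <= n)%N -> nrm (u n - l) < e.
Proof.
split=> [/cvgrPdist_lt ul e e0|ul].
  have /ul : 0 < (e%:C%C : C) by rewrite ltcR.
  by move=> -[N _ uN]; exists N => n /uN /=; rewrite distrC nrmE ltcR.
apply/cvgrPdist_lt => _ /gt0_complexP[e e0 ->].
by have [N uN] := ul _ e0; exists N => // n /uN /=; rewrite distrC nrmE ltcR.
Qed.

Lemma cvg_nrm_uniq (u : nat -> V) (l l' : V) :
  u n @[n --> \oo] --> l -> u n @[n --> \oo] --> l' -> l = l'.
Proof. exact: cvg_unique. Qed.

Lemma ball_nrmP (x y : V) (e : R) : ball x (e%:C%C : C) y <-> nrm (x - y) < e.
Proof. by rewrite -ball_normE /ball_/= nrmE ltcR. Qed.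

Lemma closure_nrmP (E : set V) (x : V) : closure E x <->
  forall e : R, 0 < e -> exists2 y, E y & nrm (x - y) < e.
Proof.
split=> [clEx e e0|clEx B /nbhs_normP[_ /= /gt0_complexP[e e0 ->] eB]].
  have /clEx[y [Ey]] : nbhs x (ball x (e%:C%C : C)).
    by apply: nbhsx_ballx; rewrite ltcR.
  by rewrite -ball_normE /ball_/= nrmE ltcR => xy; exists y.
have [y Ey xy] := clEx _ e0; exists y; split => //; apply: eB.
by rewrite /ball_/= nrmE ltcR.
Qed.

End Convergence.

Definition cauchy_seq (V : normedZmodType C) (u : nat -> V) :=
  forall e : R, 0 < e -> exists N, forall m n, (N <= m)%N -> (N <= n)%N -> nrm (u m - u n) < e.

Lemma cauchy_seq_cvg (V : completeNormedModType C) (u : nat -> V) :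
  cauchy_seq u -> exists l : V, u n @[n --> \oo] --> l.
Proof.
move=> cu; suff cvgu : cvgn u by exists (limn u).
apply: cauchy_cvg; apply/cauchy_ballP => _ /gt0_complexP[e e0 ->].
have [N cN] := cu _ e0; exists ([set u n | n in [set n | (N <= n)%N]],
   [set u n | n in [set n | (N <= n)%N]]).
  by split; exists N => //= n Nn; exists n.
move=> -[_ _] /= [[m Nm <-] [n Nn <-]].
by rewrite -ball_normE /ball_/= nrmE ltcR cN.
Qed.

Let cauchy_seq_cvgR (u : nat -> R) :
  (forall e, 0 < e -> exists N, forall m n, (N <= m)%N -> (N <= n)%N -> `|u m - u n| < e) ->
  exists l, forall e, 0 < e -> exists N, forall n, (N <= n)%N -> `|u n - l| < e.
Proof.
move=> cu; have : cvgn u.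
  apply: cauchy_cvg; apply/cauchy_ballP => e e0.
  have [N cN] := cu _ e0; exists ([set u n | n in [set n | (N <= n)%N]],
   [set u n | n in [set n | (N <= n)%N]]).
    by split; exists N => //= n Nn; exists n.
  move=> -[_ _] /= [[m Nm <-] [n Nn <-]].
  by rewrite -ball_normE /ball_/= cN.
move=> /cvg_ex[l /cvgrPdist_lt ul]; exists l => e /ul[N _ uN].
by exists N => n /uN /=; rewrite distrC.
Qed.

(** Completeness of the complex numbers, from that of R applied to the real
    and imaginary parts. *)
Lemma cauchy_seq_cvgC (u : nat -> C) :
  cauchy_seq u -> exists l : C, u n @[n --> \oo] --> l.
Proof.
move=> cu.
have [a ra] : exists l, forall e, 0 < e -> exists N, forall n, (N <= n)%N ->
    `|complex.Re (u n) - l| < e.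
  apply: cauchy_seq_cvgR => e /cu[N cN]; exists N => m n Nm Nn.
  by apply: le_lt_trans (cN m n Nm Nn); rewrite -ReN -ReD Re_le_nrm.
have [b ib] : exists l, forall e, 0 < e -> exists N, forall n, (N <= n)%N ->
    `|complex.Im (u n) - l| < e.
  apply: cauchy_seq_cvgR => e /cu[N cN]; exists N => m n Nm Nn.
  by apply: le_lt_trans (cN m n Nm Nn); rewrite -ImN -ImD Im_le_nrm.
exists (Complex a b); apply/cvg_nrmP => e e0.
have e2 : 0 < e / 2 by lra.
have [N1 h1] := ra _ e2; have [N2 h2] := ib _ e2.
exists (maxn N1 N2) => n; rewrite geq_max => /andP[/h1 + /h2].
have := nrm_le_ReIm (u n - Complex a b); rewrite ReD ImD ReN ImN /=; lra.
Qed.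

Lemma cvgC_sum (I : Type) (r : seq I) (F : I -> nat -> C) (L : I -> C) :
  (forall i, F i n @[n --> \oo] --> L i) ->
  \sum_(i <- r) F i n @[n --> \oo] --> \sum_(i <- r) L i.
Proof.
move=> FL; elim: r => [|i r IH].
  by rewrite big_nil; under eq_fun do rewrite big_nil; exact: cvg_cst.
rewrite big_cons; under eq_fun do rewrite big_cons.
by apply: cvgD; [exact: FL|exact: IH].
Qed.

Lemma cvg_conjC (u : nat -> C) (l : C) : u n @[n --> \oo] --> l ->
  Num.conj (u n) @[n --> \oo] --> Num.conj l.
Proof.
move=> /cvg_nrmP ul; apply/cvg_nrmP => e /ul[N hN]; exists N => n /hN.
by rewrite -rmorphB nrm_conj.
Qed.

End RealNorm.

(** * Summability and unconditional products *)

Section Products.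
Variable R : realType.
Local Notation C := R[i].
Implicit Types z : nat -> C.

(** Summability of a nonnegative sequence. *)
Definition bounded_sums (a : nat -> R) := exists M, forall n, \sum_(0 <= k < n) a k <= M.

Lemma sum_subset_le (a : nat -> R) (F G : seq nat) : (forall n, 0 <= a n) ->
  uniq F -> uniq G -> {subset F <= G} ->
  \sum_(k <- F) a k <= \sum_(k <- G) a k.
Proof.
move=> a0 uF uG FG; rewrite [leRHS](bigID (mem F))/= -[in leRHS]big_filter.
have /(perm_big _)-> : perm_eq [seq k <- G | k \in F] F.
  apply: uniq_perm; rewrite ?filter_uniq// => k; rewrite mem_filter.
  by case: (boolP (k \in F)) => //= /FG.
by rewrite lerDl sumr_ge0.
Qed.

Lemma bounded_sums_tail (a : nat -> R) : (forall n, 0 <= a n) -> bounded_sums a ->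
  forall e, 0 < e -> exists N, forall F, uniq F -> all (leq N) F ->
    \sum_(k <- F) a k < e.
Proof.
move=> a0 [M aM] e e0; pose S := range (fun n => \sum_(0 <= k < n) a k).
have supS : has_sup S.
  by split; [exists (\sum_(0 <= k < 0) a k), 0%N|exists M => _ [n _ <-]].
have [_ [N _ <-] ltN] := sup_adherent e0 supS.
exists N => F uF /allP NF; pose m := maxn N (\max_(i <- F) i).+1.
have FM : \sum_(k <- F) a k <= \sum_(k <- index_iota N m) a k.
  apply: sum_subset_le; rewrite ?iota_uniq// => k kF.
  rewrite mem_index_iota NF//= /m leq_max ltnS; apply/orP; right.
  exact: leq_bigmax_seq.
have mS : \sum_(0 <= k < m) a k <= sup S.
  by apply: ub_le_sup; [case: supS|exists m].
apply: le_lt_trans FM _.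
move: mS; rewrite (big_cat_nat _ (n := N)) ?leq_maxl//=; lra.
Qed.

Lemma bounded_sums_le (a a' : nat -> R) : (forall n, a n <= a' n) -> bounded_sums a' ->
  bounded_sums a.
Proof. by move=> aa' [M h]; exists M => n; apply: le_trans (h n); exact: ler_sum. Qed.

Lemma bounded_sumsD (a a' : nat -> R) : bounded_sums a -> bounded_sums a' ->
  bounded_sums (fun n => a n + a' n).
Proof.
move=> [M h] [M' h']; exists (M + M') => n.
by rewrite big_split /= lerD.
Qed.

Lemma bounded_sumsZ (c : R) (a : nat -> R) : 0 <= c -> bounded_sums a ->
  bounded_sums (fun n => c * a n).
Proof. by move=> c0 [M h]; exists (c * M) => n; rewrite -mulr_sumr ler_wpM2l. Qed.

Lemma bounded_sums_eventually (a a' : nat -> R) N : (forall n, (N <= n)%N -> a n <= a' n) ->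
  (forall n, 0 <= a' n) -> bounded_sums a' -> bounded_sums a.
Proof.
move=> aa' a'0 [M h]; exists (M + \sum_(0 <= k < N) `|a k|) => n.
apply: le_trans (_ : \sum_(0 <= k < n) (a' k + (k < N)%:R * `|a k|) <= _).
  apply: ler_sum => k _; case: ltnP => kN; last by rewrite mul0r addr0 aa'.
  by rewrite mul1r; apply: le_trans (ler_norm _) _; rewrite lerDr.
rewrite big_split /= lerD//.
rewrite (eq_bigr (fun k => if (k < N)%N then `|a k| else 0)); last first.
  by move=> k _; case: ltnP; rewrite ?mul1r ?mul0r.
rewrite -big_mkcond /= -big_filter.
apply: sum_subset_le => //; rewrite ?filter_uniq ?iota_uniq// => k.
by rewrite mem_filter !mem_index_iota /= => /andP[].
Qed.

Lemma bounded_sums_cauchy (V : normedZmodType C) (u : nat -> V) :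
  bounded_sums (fun n => nrm (u n)) ->
  cauchy_seq (fun n => \sum_(0 <= k < n) u k).
Proof.
move=> bu e e0; have [N h] := bounded_sums_tail (fun n => nrm_ge0 (u n)) bu e0.
have H m n : (N <= m)%N -> (m <= n)%N ->
    nrm (\sum_(0 <= k < n) u k - \sum_(0 <= k < m) u k) < e.
  move=> Nm mn; rewrite (big_cat_nat _ (n := m) (p := n))//= addrAC subrr add0r.
  apply: le_lt_trans (nrm_sum _ _ _) _; apply: h; rewrite ?iota_uniq//.
  by apply/allP => k; rewrite mem_index_iota => /andP[+ _]; exact: leq_trans.
exists N => m n Nm Nn; case: (leqP m n) => mn; last by apply: H => //; exact: ltnW.
by rewrite nrmC; exact: H.
Qed.

Lemma cvg_bounded_sums z : cvgn (series (fun n => `|z n|)) <->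
  bounded_sums (fun n => nrm (z n)).
Proof.
have serE n : \sum_(0 <= k < n) `|z k| = (\sum_(0 <= k < n) nrm (z k))%:C%C.
  by rewrite rmorph_sum; apply: eq_bigr => k _; rewrite nrmE.
split=> [cvs|bs].
  have /cvg_nrmP /(_ _ ltr01)[N h] : series (fun n => `|z n|) n @[n --> \oo] -->
    limn (series (fun n => `|z n|)) by [].
  exists (nrm (limn (series (fun n => `|z n|))) + 1) => n.
  have := h (maxn N n) (leq_maxl _ _); rewrite /series /= serE => h1.
  have h2 := nrmD ((\sum_(0 <= k < maxn N n) nrm (z k))%:C%C
    - limn (series (fun n => `|z n|))) (limn (series (fun n => `|z n|))).
  have s0 m : 0 <= \sum_(0 <= k < m) nrm (z k) by apply: sumr_ge0 => k _; exact: nrm_ge0.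
  rewrite subrK nrm_real ger0_norm// in h2.
  suff : \sum_(0 <= k < n) nrm (z k) <= \sum_(0 <= k < maxn N n) nrm (z k) by lra.
  by rewrite [leRHS](big_cat_nat _ (n := n)) ?leq_maxr//= lerDl sumr_ge0 // => k _; exact: nrm_ge0.
suff [l h] : exists l : C, series (fun n => `|z n|) n @[n --> \oo] --> l.
  by apply/cvg_ex; exists l.
apply/cauchy_seq_cvgC/bounded_sums_cauchy; apply: bounded_sums_le bs => n.
by rewrite nrmE nrm_real ger0_norm ?nrm_ge0.
Qed.

(** Induction on F: multiplying a product within 1 of 1 by z_k changes it by
    at most 2 |1 - z_k|. *)
Lemma prod_near1 z (F : seq nat) : \sum_(k <- F) nrm (1 - z k) <= 1/2 ->
  nrm (\prod_(k <- F) z k - 1) <= 2 * \sum_(k <- F) nrm (1 - z k).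
Proof.
elim: F => [|k F IH]; first by rewrite !big_nil subrr nrm0 mulr0.
rewrite !big_cons => kF; set w := nrm (1 - z k) in kF *.
set P := \prod_(_ <- _) _; set S := \sum_(_ <- _) _ in kF *.
have w0 : 0 <= w by exact: nrm_ge0.
have PS : nrm (P - 1) <= 2 * S by apply: IH; rewrite -/S; lra.
have -> : z k * P - 1 = (P - 1) + (z k - 1) + (z k - 1) * (P - 1) by ring.
have wE : nrm (z k - 1) = w by rewrite nrmC.
have := nrmD ((P - 1) + (z k - 1)) ((z k - 1) * (P - 1)).
have := nrmD (P - 1) (z k - 1).
have : w * nrm (P - 1) <= w * 1 by rewrite ler_wpM2l//; lra.
rewrite nrmM wE; lra.
Qed.

(** Net form of the Cauchy criterion: factors from outside [0, N) barely
    change the product over [0, N), whichever they are. *)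
Lemma prod_tail z : bounded_sums (fun n => nrm (1 - z n)) ->
  forall e, 0 < e -> exists N, forall F, uniq F -> all (leq N) F ->
   nrm ((\prod_(0 <= k < N) z k) * (\prod_(k <- F) z k) - \prod_(0 <= k < N) z k) < e.
Proof.
move=> bz e e0; have z0 n := nrm_ge0 (1 - z n).
have [N0 h0] := bounded_sums_tail z0 bz (ltac:(lra) : 0 < 1/2).
pose B := 2 * nrm (\prod_(0 <= k < N0) z k).
have B0 : 0 <= B by rewrite mulr_ge0 ?nrm_ge0.
have BN N : (N0 <= N)%N -> nrm (\prod_(0 <= k < N) z k) <= B.
  move=> N0N; rewrite (big_cat_nat _ (n := N0))//= nrmM [leRHS]mulrC ler_wpM2l ?nrm_ge0//.
  have := nrmD (\prod_(N0 <= k < N) z k - 1) 1; rewrite subrK nrm1.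
  have sl : \sum_(k <- index_iota N0 N) nrm (1 - z k) < 1/2.
    apply: h0; rewrite ?iota_uniq//; apply/allP => k.
    by rewrite mem_index_iota => /andP[].
  have := prod_near1 (ltW sl); lra.
have d0 : 0 < Num.min (1/2) (e / (2 * (B + 1))).
  by rewrite lt_min divr_gt0//= divr_gt0//; lra.
have [N1 h1] := bounded_sums_tail z0 bz d0.
exists (maxn N0 N1) => F uF NF; rewrite -[X in _ - X]mulr1 -mulrBr nrmM.
have {}h1 : \sum_(k <- F) nrm (1 - z k) < Num.min (1/2) (e / (2 * (B + 1))).
  by apply: h1 => //; apply: sub_all NF => k; rewrite geq_max => /andP[].
move: h1; rewrite lt_min => /andP[h1 h2].
have h3 := prod_near1 (ltW h1); have h4 := BN _ (leq_maxl N0 N1).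
apply: (@le_lt_trans _ _ (B * (2 * \sum_(k <- F) nrm (1 - z k)))).
  by apply: ler_pM => //; exact: nrm_ge0.
apply: (@le_lt_trans _ _ ((2 * (B+1)) * \sum_(k <- F) nrm (1 - z k))).
  have : 0 <= \sum_(k <- F) nrm (1 - z k) by exact: sumr_ge0.
  by rewrite mulrCA mulrA; move=> ?; apply: ler_wpM2r => //; lra.
by rewrite mulrC -ltr_pdivlMr//; lra.
Qed.

Lemma surj_prefix (s : nat -> nat) (N : nat) : bijective s ->
  exists M, forall n k, (M <= n)%N -> (k < N)%N -> k \in [seq s i | i <- index_iota 0 n].
Proof.
move=> [t st ts]; exists (\max_(i < N) t i).+1 => n k Mn kN.
apply/mapP; exists (t k) => //; rewrite mem_index_iota /=.
by apply: leq_trans Mn; rewrite ltnS (leq_bigmax (Ordinal kN)).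
Qed.

(** Every reordering eventually contains the factors below N of [prod_tail],
    so all reorderings share the limit of the partial products. *)
Lemma bounded_sums_unconditional_prod z :
  bounded_sums (fun n => nrm (1 - z n)) -> exists a, unconditional_prod z a.
Proof.
move=> bz; pose P N := \prod_(0 <= k < N) z k.
have near_P s : bijective s -> forall e, 0 < e -> forall N,
    (forall F, uniq F -> all (leq N) F -> nrm (P N * (\prod_(k <- F) z k) - P N) < e) ->
    exists M, forall n, (M <= n)%N -> nrm (\prod_(0 <= k < n) z (s k) - P N) < e.
  move=> bs e e0 N hN; have [M hM] := surj_prefix N bs; exists M => n Mn.
  have us : uniq [seq s i | i <- index_iota 0 n].
    by rewrite map_inj_uniq ?iota_uniq//; exact: bij_inj.
  pose F := [seq k <- [seq s i | i <- index_iota 0 n] | (N <= k)%N].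
  have -> : \prod_(0 <= k < n) z (s k) = P N * \prod_(k <- F) z k.
    rewrite -(big_map s predT z) (bigID (fun k => k < N)%N)/=; congr (_ * _).
      rewrite -big_filter; apply: perm_big; apply: uniq_perm.
      - by rewrite filter_uniq.
      - exact: iota_uniq.
      - move=> k; rewrite mem_filter mem_index_iota /=.
        by case: ltnP => //= kN; apply: hM.
    by rewrite big_filter; apply: eq_bigl => k; rewrite -leqNgt.
  by apply: hN; [exact: filter_uniq|exact: filter_all].
have [a Pa] : exists a : C, P n @[n --> \oo] --> a.
  apply: cauchy_seq_cvgC => e e0; have e2 : 0 < e / 2 by lra.
  have [N hN] := prod_tail bz e2.
  have [M hM] := near_P id (ltac:(by exists id)) _ e2 _ hN.
  exists M => m n /hM hm /hM hn.
  by apply: le_lt_trans (nrm_tri _ (P N) _) _; rewrite (nrmC (P N)) /P; move: hm hn; lra.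
exists a => s bs; apply/cvg_nrmP => e e0; have e2 : 0 < e / 3 by lra.
have [N hN] := prod_tail bz e2.
have [M hM] := near_P s bs _ e2 _ hN.
have [M' hM'] := near_P id (ltac:(by exists id)) _ e2 _ hN.
have [M2 hM2] := (cvg_nrmP P a).1 Pa _ e2.
exists M => n /hM h1.
have := nrm_tri (\prod_(0 <= k < n) z (s k)) (P N) a.
have := nrm_tri (P N) (P (maxn M' M2)) a.
have := hM' _ (leq_maxl M' M2); have := hM2 _ (leq_maxr M' M2).
rewrite (nrmC (P N) (P (maxn _ _))) /P; move: h1; rewrite /P; lra.
Qed.

(** Rearranging each block [b k, b k.+1) separately gives a bijection of nat. *)
Lemma block_permutation (b : nat -> nat) (L : nat -> seq nat) :
  b 0%N = 0%N -> (forall k, b k < b k.+1)%N ->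
  (forall k, perm_eq (L k) (index_iota (b k) (b k.+1))) ->
  exists2 s, bijective s &
    forall k, [seq s n | n <- index_iota (b k) (b k.+1)] = L k.
Proof.
move=> b0 bS permL.
have bmono : {homo b : i j / (i < j)%N} by apply: homo_ltn => //; exact: ltn_trans.
have bmono' : {homo b : i j / (i <= j)%N}.
  by move=> i j; rewrite leq_eqVlt => /orP[/eqP->//|/bmono/ltnW].
have bge k : (k <= b k)%N by elim: k => // k IH; exact: leq_ltn_trans IH (bS k).
have blk_ex n : exists k, (n < b k.+1)%N by exists n; exact: bge n.+1.
pose blk n := ex_minn (blk_ex n).
have blkP n k : ((b k <= n) && (n < b k.+1))%N -> blk n = k.
  move=> /andP[kn nk]; rewrite /blk; case: ex_minnP => m nm minm.
  apply/eqP; rewrite eqn_leq minm//= leqNgt; apply/negP => mk.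
  by have := leq_trans nm (leq_trans (bmono' _ _ mk) kn); rewrite ltnn.
have blkE n : ((b (blk n) <= n) && (n < b (blk n).+1))%N.
  rewrite /blk; case: ex_minnP => -[|m] nm minm; rewrite nm andbT ?b0//.
  by rewrite leqNgt; apply/negP => /minm; rewrite ltnn.
have memL k m : (m \in L k) = ((b k <= m) && (m < b k.+1))%N.
  by rewrite (perm_mem (permL k)) mem_index_iota.
have sizeL k : size (L k) = (b k.+1 - b k)%N by rewrite (perm_size (permL k)) size_iota.
have uniqL k : uniq (L k) by rewrite (perm_uniq (permL k)) iota_uniq.
pose s n := nth 0%N (L (blk n)) (n - b (blk n)).
pose t m := (b (blk m) + index m (L (blk m)))%N.
have szn n : (n - b (blk n) < size (L (blk n)))%N.
  by rewrite sizeL ltn_sub2r//; case/andP: (blkE n) => h1 h2 //; exact: leq_ltn_trans h2.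
have blks n : blk (s n) = blk n by apply: blkP; rewrite -memL mem_nth.
have blkt m : blk (t m) = blk m.
  apply: blkP; rewrite leq_addr /= -ltn_subRL -sizeL index_mem memL; exact: blkE.
exists s.
  exists t => n.
    rewrite /t blks /s index_uniq// subnKC//; by case/andP: (blkE n).
  by rewrite /s blkt /t addKn nth_index// memL.
move=> k; apply: (@eq_from_nth _ 0%N); first by rewrite size_map size_iota sizeL.
move=> i; rewrite size_map size_iota => ik.
have bi : blk (b k + i) = k by apply: blkP; rewrite leq_addr /= -ltn_subRL.
by rewrite (nth_map 0%N) ?size_iota// nth_iota// /s bi addKn.
Qed.

(** Otherwise, beyond every N there is a finite set F whose product is far
    from 1.  A permutation that lists such a set at the beginning of each of
    infinitely many blocks has partial products that jump by a fixed factor,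
    so they cannot converge to a nonzero limit. *)
Lemma unconditional_prod_tail z a : unconditional_prod z a -> a != 0 ->
  exists N, forall F, uniq F -> all (leq N) F ->
    nrm (\prod_(k <- F) z k - 1) <= 1/4.
Proof.
move=> za a0; apply: contrapT => noN.
have bad N : exists F, [/\ uniq F, all (leq N) F & 1/4 < nrm (\prod_(k <- F) z k - 1)].
  apply: contrapT => noF; apply: noN; exists N => F uF NF.
  by rewrite leNgt; apply/negP => h; apply: noF; exists F.
have [F FP] := choice bad.
pose next N := (maxn N (\max_(i <- F N) i)).+1.
pose b := fix b k := if k is k'.+1 then next (b k') else 0%N.
have bS k : (b k < b k.+1)%N by rewrite ltnS leq_maxl.
(* F (b k) lies in the k-th block by the choice of the next endpoint. *)
pose L k := F (b k) ++ [seq i <- index_iota (b k) (b k.+1) | i \notin F (b k)].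
have Fsub k : {subset F (b k) <= index_iota (b k) (b k.+1)}.
  move=> i iF; have [_ /allP/(_ _ iF) + _] := FP (b k); rewrite mem_index_iota => -> /=.
  by rewrite ltnS leq_max; apply/orP; right; exact: leq_bigmax_seq.
have permL k : perm_eq (L k) (index_iota (b k) (b k.+1)).
  have [uF _ _] := FP (b k); apply: uniq_perm; rewrite ?iota_uniq//.
    rewrite cat_uniq uF filter_uniq ?iota_uniq// andbT /=.
    by apply/hasPn => i; rewrite mem_filter => /andP[].
  move=> i; rewrite mem_cat mem_filter; case: (boolP (i \in F (b k))) => //= /Fsub.
  by move->.
have [s bs sL] := block_permutation erefl bS permL.
have al0 : 0 < nrm a.
  rewrite lt_def nrm_ge0 andbT; apply: contra a0 => /eqP /nrm_eq0 ->; exact: eqxx.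
(* With eta = |a| / 16, both partial products P and P * Q lie within eta of a,
   while |P| > 15 eta and |Q - 1| > 1/4 give |P * Q - P| > 2 eta. *)
have e0 : 0 < nrm a / 16 by lra.
have [N hN] := (cvg_nrmP _ _).1 (za s bs) _ e0.
have bge k : (k <= b k)%N by elim: k => // k IH; exact: leq_ltn_trans IH (bS k).
have := hN _ (bge N); have [_ _ hF] := FP (b N).
have Nl : (N <= b N + size (F (b N)))%N by exact: leq_trans (bge N) (leq_addr _ _).
have := hN _ Nl; rewrite (big_cat_nat _ (n := b N)) ?leq_addr//=.
have szF : (size (F (b N)) <= b N.+1 - b N)%N.
  by have := perm_size (permL N); rewrite size_iota => <-; rewrite size_cat leq_addr.
have -> : \prod_(b N <= k < b N + size (F (b N))) z (s k) = \prod_(k <- F (b N)) z k.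
  rewrite -(big_map s predT z); congr bigop.
  have := congr1 (take (size (F (b N)))) (sL N); rewrite take_size_cat// -map_take => E.
  by rewrite -[RHS]E; congr map; rewrite /index_iota take_iota (minn_idPl szF) addKn.
set P := \prod_(0 <= k < b N) z (s k); set Q := \prod_(k <- F (b N)) z k in hF *.
move=> h1 h2; have := nrm_tri (P * Q) a P; have := nrm_tri a P 0.
rewrite !subr0 (nrmC a) => h3 h4.
have : nrm (P * Q - P) = nrm P * nrm (Q - 1) by rewrite -nrmM mulrBr mulr1.
have : nrm P * (1 / 4) <= nrm P * nrm (Q - 1) by rewrite ler_wpM2l ?nrm_ge0// ltW.
move: h1 h2 h3 h4 al0; lra.
Qed.

(** When all factors z_k - 1 lie in the cone of angle 60 degrees around a
    fixed direction and the partial products stay near 1, each factor moves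
    the product in that direction by at least |z_k - 1| / 4, so the moves
    cannot cancel. *)
Lemma cone_sum_le (lam : C) z (F : seq nat) : nrm lam <= 1 ->
  {in F, forall k, nrm (z k - 1) <= 2 * complex.Re (lam * (z k - 1))} ->
  (forall n, nrm (\prod_(k <- take n F) z k - 1) <= 1/4) ->
  \sum_(k <- F) nrm (z k - 1) <= 4 * complex.Re (lam * (\prod_(k <- F) z k - 1)).
Proof.
move=> lam1; elim/last_ind: F => [|F k IH] cone prefix.
  by rewrite !big_nil subrr mulr0 mulr0.
have {}IH := IH (fun i iF => cone i (ltac:(by rewrite mem_rcons inE iF orbT))) _.
rewrite -cats1 !big_cat !big_seq1 /=.
set P := \prod_(_ <- _) _ in IH *; set w := z k - 1.
have -> : P * z k - 1 = (P - 1) + w + (P - 1) * w by rewrite /w; ring.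
have P4 : nrm (P - 1) <= 1/4.
  by have := prefix (size F); rewrite -cats1 take_size_cat.
have {}IH : \sum_(i <- F) nrm (z i - 1) <= 4 * complex.Re (lam * (P - 1)).
  apply: IH => n; have := prefix (minn n (size F)).
  by rewrite -cats1 takel_cat ?geq_minr// take_min take_size.
rewrite (mulrDr lam (P - 1 + w)) (mulrDr lam (P - 1) w) !ReD.
have := cone k (ltac:(by rewrite mem_rcons mem_head)); rewrite -/w => wRe.
have := Re_le_nrm (lam * ((P - 1) * w)); rewrite !nrmM ler_norml => /andP[h _].
have : nrm lam * (nrm (P - 1) * nrm w) <= 1 * (1/4 * nrm w).
  by rewrite ler_pM ?mulr_ge0 ?nrm_ge0// ler_wpM2r ?nrm_ge0.
lra.
Qed.

(** Four cones as in [cone_sum_le], around 1, -1, i and -i, cover the plane,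
    and products over finite sets of large indices stay within 1/4 of 1. *)
Lemma unconditional_prod_bounded_sums z a : unconditional_prod z a -> a != 0 ->
  bounded_sums (fun n => nrm (1 - z n)).
Proof.
move=> za a0; have [N hN] := unconditional_prod_tail za a0.
have cone_le (lam : C) (G : seq nat) : nrm lam <= 1 -> uniq G -> all (leq N) G ->
    \sum_(k <- G | nrm (z k - 1) <= 2 * complex.Re (lam * (z k - 1))) nrm (z k - 1) <= 1.
  move=> lam1 uG NG; rewrite -big_filter.
  pose F := [seq k <- G | nrm (z k - 1) <= 2 * complex.Re (lam * (z k - 1))].
  rewrite -/F.
  have uF : uniq F by exact: filter_uniq.
  have NF : all (leq N) F.
    by apply/allP => k; rewrite mem_filter => /andP[_]; exact: (allP NG).
  apply: le_trans (cone_sum_le (lam := lam) _ _ _) _ => //.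
  - by move=> k; rewrite mem_filter => /andP[].
  - move=> n; apply: hN; first exact: take_uniq.
    by apply/allP => k /mem_take; exact: (allP NF).
  - have := Re_le_nrm (lam * (\prod_(k <- F) z k - 1)); rewrite ler_norml nrmM => /andP[_ h].
    have : nrm lam * nrm (\prod_(k <- F) z k - 1) <= 1 * (1/4).
      by rewrite ler_pM ?nrm_ge0// hN.
    lra.
pose c0 : C := 1; pose c1 : C := -1; pose c2 : C := Complex 0 1; pose c3 : C := Complex 0 (-1).
have nc : [/\ nrm c0 <= 1, nrm c1 <= 1, nrm c2 <= 1 & nrm c3 <= 1].
  by rewrite /c0 /c1 nrmN nrm1 /nrm !normc_def /= !expr0n !add0r expr1n sqrrN expr1n sqrtr1.
pose w k := nrm (z k - 1).
pose P (lam : C) k := nrm (z k - 1) <= 2 * complex.Re (lam * (z k - 1)).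
have tail n : \sum_(N <= k < n) w k <= 4.
  have NG : all (leq N) (index_iota N n).
    by apply/allP => k; rewrite mem_index_iota => /andP[].
  have uG : uniq (index_iota N n) by exact: iota_uniq.
  case: nc => n0 n1 n2 n3.
  have := cone_le _ _ n0 uG NG; have := cone_le _ _ n1 uG NG.
  have := cone_le _ _ n2 uG NG; have := cone_le _ _ n3 uG NG.
  rewrite !(big_mkcond (fun k => _ <= _)).
  suff : \sum_(N <= k < n) w k <= \sum_(N <= k < n) ((if P c0 k then w k else 0)
     + (if P c1 k then w k else 0) + (if P c2 k then w k else 0) + (if P c3 k then w k else 0)).
    by rewrite !big_split /= /P /w; lra.
  apply: ler_sum => k _; have w0 : 0 <= w k by exact: nrm_ge0.
  rewrite /P !ReM /=.
  have := nrm_le_ReIm (z k - 1); rewrite -/(w k).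
  case: ifPn => p0; case: ifPn => p1; case: ifPn => p2; case: ifPn => p3; try lra.
  rewrite -!ltNge in p0 p1 p2 p3; rewrite !addr0 => h.
  have : 0 <= complex.Re (z k - 1) \/ complex.Re (z k - 1) <= 0.
    by case: (leP 0 (complex.Re (z k - 1))); [left|right; exact: ltW].
  have : 0 <= complex.Im (z k - 1) \/ complex.Im (z k - 1) <= 0.
    by case: (leP 0 (complex.Im (z k - 1))); [left|right; exact: ltW].
  move: h => /[swap] -[/ger0_norm|/ler0_norm] -> /[swap] -[/ger0_norm|/ler0_norm] ->; lra.
exists (\sum_(0 <= k < N) w k + 4) => n.
rewrite (eq_bigr w) => [|k _]; last by rewrite /w nrmC.
apply: (@le_trans _ _ (\sum_(0 <= k < maxn N n) w k)).
  apply: sum_subset_le; [by move=> k; exact: nrm_ge0|exact: iota_uniq|exact: iota_uniq|move=> k].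
  by rewrite !mem_index_iota /= => kn; rewrite leq_max kn orbT.
by rewrite (big_cat_nat _ (n := N)) ?leq_maxl//= lerD2l tail.
Qed.

Lemma unconditional_prod_cvg z a : unconditional_prod z a ->
  \prod_(0 <= k < n) z k @[n --> \oo] --> a.
Proof. by move=> /(_ id (ltac:(by exists id))). Qed.

Lemma qprodE z a : unconditional_prod z a -> qprod z = a.
Proof.
move=> za; rewrite /qprod; case: xgetP => [b _ zb|/(_ a)//].
by apply: cvg_nrm_uniq (unconditional_prod_cvg zb) (unconditional_prod_cvg za).
Qed.

Lemma qprod_divergent z : ~ (exists a, unconditional_prod z a) -> qprod z = 0.
Proof.
move=> noz; rewrite /qprod; case: xgetP => // a _ za.
by exfalso; apply: noz; exists a.
Qed.

Lemma qprod_cvg z : bounded_sums (fun n => nrm (1 - z n)) ->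
  \prod_(0 <= k < n) z k @[n --> \oo] --> qprod z.
Proof.
move=> /bounded_sums_unconditional_prod[a za]; rewrite (qprodE za).
exact: unconditional_prod_cvg.
Qed.

Lemma qprod_neq0_bounded_sums z : qprod z != 0 ->
  bounded_sums (fun n => nrm (1 - z n)).
Proof.
rewrite /qprod; case: xgetP => [a _ za a0|_]; last by rewrite eqxx.
exact: unconditional_prod_bounded_sums za a0.
Qed.

Lemma bounded_sums_eventually0 (a : nat -> R) N :
  (forall n, (N <= n)%N -> a n = 0) -> bounded_sums a.
Proof.
move=> a0; apply: (@bounded_sums_eventually _ (fun=> 0) N) => // [n /a0->//|].
by exists 0 => n; rewrite big1.
Qed.

Lemma qprod_eventually1 z N : (forall n, (N <= n)%N -> z n = 1) ->
  qprod z = \prod_(0 <= k < N) z k.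
Proof.
move=> z1; have /qprod_cvg : bounded_sums (fun n => nrm (1 - z n)).
  by apply: (@bounded_sums_eventually0 _ N) => n /z1 ->; rewrite subrr nrm0.
move=> /cvg_nrm_uniq; apply; apply/cvg_nrmP => e e0; exists N => n Nn.
rewrite (big_cat_nat _ (n := N))//= [X in _ * X]big_nat_cond [X in _ * X]big1 => [|k].
  by rewrite mulr1 subrr nrm0.
by rewrite andbT => /andP[/z1].
Qed.

Lemma unconditional_prod_dominated0 z u v a :
  (forall n, nrm (z n) <= nrm (u n) * nrm (v n)) ->
  unconditional_prod u 0 -> unconditional_prod v a -> unconditional_prod z 0.
Proof.
move=> zuv u0 va s bs; apply/cvg_nrmP => e e0.
have [N hN] := (cvg_nrmP _ _).1 (va s bs) _ ltr01.
have e1 : 0 < e / (nrm a + 1) by rewrite divr_gt0// ltr_wpDl ?nrm_ge0.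
have [N' hN'] := (cvg_nrmP _ _).1 (u0 s bs) _ e1.
exists (maxn N N') => n; rewrite geq_max => /andP[/hN h1 /hN'].
rewrite !subr0 !nrm_prod ltr_pdivlMr; last by rewrite ltr_wpDl ?nrm_ge0.
apply: le_lt_trans.
apply: (@le_trans _ _ (\prod_(0 <= k < n) nrm (u (s k)) * \prod_(0 <= k < n) nrm (v (s k)))).
  by rewrite -big_split /=; apply: ler_prod => k _; rewrite nrm_ge0 zuv.
apply: ler_wpM2l; first by apply: prodr_ge0 => k _; exact: nrm_ge0.
rewrite -nrm_prod; have := nrmD (\prod_(0 <= k < n) v (s k) - a) a.
by rewrite subrK; lra.
Qed.

Lemma conj_qprod (z : nat -> C) : qprod (fun n => Num.conj (z n)) = Num.conj (qprod z).
Proof.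
have conjP (u : nat -> C) (a : C) : unconditional_prod u a ->
    unconditional_prod (fun n => Num.conj (u n)) (Num.conj a).
  move=> ua s bs; have := cvg_conjC (ua s bs).
  by under eq_fun do rewrite rmorph_prod.
have [[a za]|noa] := pselect (exists a, unconditional_prod z a).
  by rewrite (qprodE za) (qprodE (conjP _ _ za)).
rewrite (qprod_divergent noa) rmorph0 qprod_divergent// => -[a /conjP za].
apply: noa; exists (Num.conj a).
by move: za; under eq_fun do rewrite conjCK.
Qed.

Lemma bounded_sums_sqr (z : nat -> C) : bounded_sums (fun n => nrm (1 - z n)) ->
  bounded_sums (fun n => nrm (1 - z n ^+ 2)).
Proof.
move=> bz; have [M hM] := bz.
have zM n : nrm (1 - z n) <= M.
  apply: le_trans (hM n.+1); rewrite big_nat_recr //= lerDr.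
  by apply: sumr_ge0 => k _; exact: nrm_ge0.
have M0 : 0 <= M by apply: le_trans (zM 0%N); exact: nrm_ge0.
apply: bounded_sums_le (bounded_sumsZ (_ : 0 <= 2 + M) bz) => [n|]; last lra.
have -> : 1 - z n ^+ 2 = (1 - (1 - z n) + 1) * (1 - z n) by ring.
rewrite nrmM; apply: ler_wpM2r; first exact: nrm_ge0.
have := nrmD (2 : C) (- (1 - z n)); rewrite nrmN.
have -> : 2 - (1 - z n) = 1 - (1 - z n) + 1 by ring.
have := nrmD (1 : C) 1; rewrite nrm1; have := zM n; lra.
Qed.

Lemma bounded_sums_small (a : nat -> R) : (forall n, 0 <= a n) -> bounded_sums a ->
  forall e, 0 < e -> exists N, forall n, (N <= n)%N -> a n < e.
Proof.
move=> a0 ba e /(bounded_sums_tail a0 ba)[N hN]; exists N => n Nn.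
by have := hN [:: n]; rewrite big_seq1; apply => //=; rewrite Nn.
Qed.

Lemma bounded_sums_half : bounded_sums (fun n => (1 / 2 : R) ^+ n).
Proof.
exists 2 => n; have -> : \sum_(0 <= k < n) (1 / 2 : R) ^+ k = 2 - 2 * (1 / 2) ^+ n.
  elim: n => [|n IH]; first by rewrite big_geq// expr0; lra.
  by rewrite big_nat_recr//= IH exprS; lra.
have : 0 <= (1 / 2 : R) ^+ n by apply: exprn_ge0; lra.
by lra.
Qed.

Lemma unconditional_prod_half : unconditional_prod (fun=> (1 / 2 : R)%:C%C : C) 0.
Proof.
move=> s _; apply/cvg_nrmP => e e0.
have [N hN] := bounded_sums_small (fun n => exprn_ge0 n (ltac:(lra) : 0 <= 1 / 2))
  bounded_sums_half e0.
exists N => n /hN; rewrite subr0 nrm_prod nrm_real ger0_norm; last lra.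
by rewrite prodr_const_nat subn0.
Qed.

(** Finitely many factors do not prevent the geometric decay of the others. *)
Lemma unconditional_prod_contract0 z N :
  (forall n, (N <= n)%N -> nrm (z n) <= 1 / 2) -> unconditional_prod z 0.
Proof.
move=> z2; (* Dominate z by the constant 1/2 times a sequence that is eventually 1. *)
pose v n : C := if (n < N)%N then (2 * nrm (z n))%:C%C else 1.
have [b vb] : exists b, unconditional_prod v b.
  apply: bounded_sums_unconditional_prod; apply: (@bounded_sums_eventually0 _ N) => n Nn.
  by rewrite /v ltnNge Nn /= subrr nrm0.
apply: unconditional_prod_dominated0 unconditional_prod_half vb => n.
rewrite nrm_real ger0_norm; last lra.
rewrite /v; case: ltnP => [nN|/z2]; last by rewrite nrm1 mulr1.
by rewrite nrm_real ger0_norm ?mulr_ge0 ?nrm_ge0//; have := nrm_ge0 (z n); lra.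
Qed.

(** This holds even when the product does not converge: if z_i is nonzero then
    removing it does not affect convergence, and if z_i = 0 both sides are 0. *)
Lemma qprod_factor z i :
  qprod z = z i * qprod (fun n => if n == i then 1 else z n).
Proof.
set z' := fun n => _.
have prodE (s : nat -> nat) : bijective s -> exists N, forall n, (N <= n)%N ->
    \prod_(0 <= k < n) z (s k) = z i * \prod_(0 <= k < n) z' (s k).
  move=> [t st ts]; exists (t i).+1 => n tn.
  have ti : t i \in index_iota 0 n by rewrite mem_index_iota.
  rewrite (bigD1_seq (t i)) ?iota_uniq//= ts; congr (_ * _).
  rewrite [RHS](bigD1_seq (t i)) ?iota_uniq//= {1}/z' ts eqxx mul1r.
  apply: eq_bigr => k kti; rewrite /z' ifN//; apply: contra kti => /eqP <-.
  by rewrite st.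
have [[b z'b]|noz'] := pselect (exists b, unconditional_prod z' b).
  rewrite (qprodE z'b); apply: qprodE => s bs; have [N hN] := prodE s bs.
  apply/cvg_nrmP => e e0; have d0 : 0 < e / (nrm (z i) + 1).
    by rewrite divr_gt0// ltr_wpDl ?nrm_ge0.
  have [M hM] := (cvg_nrmP _ _).1 (z'b s bs) _ d0; exists (maxn N M) => n.
  rewrite geq_max => /andP[/hN -> /hM]; rewrite -mulrBr nrmM.
  rewrite ltr_pdivlMr ?ltr_wpDl ?nrm_ge0// => h; apply: le_lt_trans h.
  by rewrite mulrC ler_wpM2l ?nrm_ge0// lerDl.
rewrite (qprod_divergent noz') mulr0; have [zi0|zi0] := eqVneq (z i) 0.
  apply: qprodE => s bs; have [N hN] := prodE s bs; apply/cvg_nrmP => e e0.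
  by exists N => n /hN ->; rewrite zi0 mul0r subr0 nrm0.
apply: qprod_divergent => -[a za]; apply: noz'; exists (a / z i) => s bs.
have [N hN] := prodE s bs; apply/cvg_nrmP => e e0.
have zi : 0 < nrm (z i).
  by rewrite lt_def nrm_ge0 andbT; apply: contra zi0 => /eqP/nrm_eq0/eqP.
have [M hM] := (cvg_nrmP _ _).1 (za s bs) _ (mulr_gt0 zi e0).
exists (maxn N M) => n; rewrite geq_max => /andP[/hN h /hM]; rewrite h.
set P := \prod_(0 <= k < n) _; have -> : z i * P - a = z i * (P - a / z i) by field.
by rewrite nrmM ltr_pM2l.
Qed.

Lemma absolutely_cvg_series (V : completeNormedModType C) (u : nat -> V) :
  bounded_sums (fun n => nrm (u n)) ->
  exists l : V, \sum_(0 <= k < n) u k @[n --> \oo] --> l.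
Proof.
by move=> /bounded_sums_cauchy/cauchy_seq_cvg.
Qed.

End Products.

(** * Reproducing kernel Hilbert spaces *)

Section Misc.
Variable R : realType.
Local Notation C := R[i].

Lemma ge0_ReE (z : C) : 0 <= z -> z = (complex.Re z)%:C%C.
Proof. by move=> z0; rewrite RRe_real// realE z0. Qed.

Lemma Re_ge0 (z : C) : 0 <= z -> 0 <= complex.Re z.
Proof. by move=> /[dup] /ge0_ReE {1}->; rewrite ler0c. Qed.

Lemma mulC_conj (z : C) : z * Num.conj z = (nrm z ^+ 2)%:C%C.
Proof. by rewrite -normCK nrmE rmorphXn. Qed.

Lemma le_eps (x y : R) : (forall e, 0 < e -> x <= y + e) -> x <= y.
Proof.
by move=> h; rewrite leNgt; apply/negP => xy; have := h ((x - y) / 2); lra.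
Qed.

Lemma cvgC_ge0 (u : nat -> C) (l : C) : u n @[n --> \oo] --> l ->
  (forall n, 0 <= u n) -> 0 <= l.
Proof.
move=> /cvg_nrmP ul u0; rewrite lecE /= eq_sym; apply/andP; split.
  rewrite eq_sym -normr_le0; apply: le_eps => e /ul[N /(_ N (leqnn N)) uN].
  have := Im_le_nrm (u N - l); rewrite ImD ImN (ge0_ReE (u0 N)) /= sub0r normrN.
  by rewrite -(ge0_ReE (u0 N)) add0r; move: uN; lra.
apply: le_eps => e /ul[N /(_ N (leqnn N)) uN].
have := Re_le_nrm (u N - l); rewrite ReD ReN ler_norml => /andP[_].
by have := Re_ge0 (u0 N); move: uN; lra.
Qed.

(** The values of r are those of the squared norm of s - r c t, with
    a = |s|^2, b = |t|^2 and c = <s, t>.  Real r suffice because c carries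
    the phase.  The case b = 0 is needed for semidefinite forms. *)
Lemma cauchy_schwarz_quadratic (a b : R) (c : C) : 0 <= a -> 0 <= b ->
  (forall r : R, 0 <= a - 2 * r * nrm c ^+ 2 + r ^+ 2 * nrm c ^+ 2 * b) ->
  nrm c <= Num.sqrt a * Num.sqrt b.
Proof.
move=> a0 b0 q; rewrite -sqrtrM// -[leLHS]ger0_norm ?nrm_ge0// -sqrtr_sqr.
rewrite ler_wsqrtr//; set n := nrm c ^+ 2 in q *.
have n0 : 0 <= n by exact: sqr_ge0.
have [b1|b1] := ltrP 0 b.
  have := q b^-1; rewrite expr2.
  have -> : b^-1 * b^-1 * n * b = b^-1 * n by field; lra.
  move=> h; have : 0 <= (a - b^-1 * n) * b by apply: mulr_ge0 => //; lra.
  by rewrite mulrBl mulrAC mulVf ?mul1r; [lra|exact: lt0r_neq0].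
have -> : b = 0 by lra.
rewrite mulr0 leNgt; apply/negP => n1; have := q ((a + 1) / (2 * n)).
have -> : 2 * ((a + 1) / (2 * n)) * n = a + 1 by field; lra.
have -> : b = 0 by lra.
rewrite mulr0; lra.
Qed.

End Misc.

Definition psd (R : realType) (X : Type) (kappa : X -> X -> R[i]) :=
  forall s : seq (R[i] * X),
  0 <= \sum_(p <- s) \sum_(q <- s) p.1 * Num.conj q.1 * kappa p.2 q.2.

(** A positive semidefinite kernel determines a Hilbert space of functions on
    X in which evaluation at x is the inner product with k x.  Formal linear
    combinations of points, as lists, give a semidefinite inner product space;
    the Hilbert space consists of the functions that can be approximated by
    them. *)
Record psd_kernel (R : realType) (X : Type) := PsdKernel {
  kfun :> X -> X -> R[i];
  kfun_herm : forall x y, kfun x y = Num.conj (kfun y x);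
  kfun_psd : psd kfun }.

Section Combinations.
Variables (R : realType) (X : Type) (k : psd_kernel R X).
Local Notation C := R[i].
Local Notation comb := (seq (C * X)).
Implicit Types (s t : comb) (f g : X -> C).

Definition scale_comb (a : C) s : comb := [seq (a * p.1, p.2) | p <- s].
Definition ev s : X -> C := fun x => \sum_(p <- s) p.1 * k p.2 x.
(** The inner product of f with the combination t, by the reproducing
    property.  It makes sense for every function f. *)
Definition pair t f : C := \sum_(q <- t) Num.conj q.1 * f q.2.
Definition bform s t : C := pair t (ev s).
Definition bnorm s : R := Num.sqrt (complex.Re (bform s s)).
Definition lincomb (a : C) s t := scale_comb a s ++ t.

Lemma ev_lincomb a s t : ev (lincomb a s t) = a *: ev s + ev t.
Proof.
apply/funext => x; rewrite -[RHS]/(a * ev s x + ev t x) /ev big_cat big_map /=.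
by congr (_ + _); rewrite mulr_sumr; apply: eq_bigr => p _; rewrite mulrA.
Qed.

Lemma pairDr a t f g : pair t (a *: f + g) = a * pair t f + pair t g.
Proof.
rewrite /pair mulr_sumr -big_split; apply: eq_bigr => q _ /=.
by rewrite mulrDr; congr (_ + _); rewrite mulrCA.
Qed.

Lemma pairBr t f g : pair t (f - g) = pair t f - pair t g.
Proof.
by rewrite /pair -sumrB; apply: eq_bigr => q _; rewrite -mulrBr.
Qed.

Lemma pair_lincomb a s t f :
  pair (lincomb a s t) f = Num.conj a * pair s f + pair t f.
Proof.
rewrite /pair big_cat big_map /=; congr (_ + _).
by rewrite mulr_sumr; apply: eq_bigr => p _; rewrite rmorphM mulrA.
Qed.

Lemma bform_lincombl a s s' t :
  bform (lincomb a s s') t = a * bform s t + bform s' t.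
Proof. by rewrite /bform ev_lincomb pairDr. Qed.

Lemma bform_lincombr a s t t' :
  bform s (lincomb a t t') = Num.conj a * bform s t + bform s t'.
Proof. exact: pair_lincomb. Qed.

Lemma bformE s t : bform s t =
  \sum_(p <- s) \sum_(q <- t) p.1 * Num.conj q.1 * k p.2 q.2.
Proof.
rewrite /bform /pair /ev exchange_big; apply: eq_bigr => q _ /=.
by rewrite mulr_sumr; apply: eq_bigr => p _; rewrite mulrA (mulrC p.1).
Qed.

Lemma bform_conj s t : bform s t = Num.conj (bform t s).
Proof.
rewrite !bformE rmorph_sum exchange_big; apply: eq_bigr => q _ /=.
rewrite rmorph_sum; apply: eq_bigr => p _ /=.
by rewrite kfun_herm !rmorphM /= conjCK (mulrC p.1).
Qed.

Lemma bform_ge0 s : 0 <= bform s s.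
Proof. by rewrite bformE; exact: kfun_psd. Qed.

Lemma bnorm_ge0 s : 0 <= bnorm s.
Proof. exact: sqrtr_ge0. Qed.

Lemma bform_bnorm s : bform s s = (bnorm s ^+ 2)%:C%C.
Proof. by rewrite sqr_sqrtr ?Re_ge0 ?bform_ge0// -ge0_ReE ?bform_ge0. Qed.

Lemma bform_cauchy_schwarz s t : nrm (bform s t) <= bnorm s * bnorm t.
Proof.
apply: cauchy_schwarz_quadratic; rewrite ?Re_ge0 ?bform_ge0// => r.
have := Re_ge0 (bform_ge0 (lincomb (- (r%:C%C * bform s t)) t s)).
rewrite bform_lincombl !bform_lincombr (bform_conj t s) !bform_bnorm.
set c := bform s t.
have -> : - (r%:C%C * c) * (Num.conj (- (r%:C%C * c)) * (bnorm t ^+ 2)%:C%C + Num.conj c)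
   + (Num.conj (- (r%:C%C * c)) * c + (bnorm s ^+ 2)%:C%C) =
   (bnorm s ^+ 2 - 2 * r * nrm c ^+ 2 + r ^+ 2 * nrm c ^+ 2 * bnorm t ^+ 2)%:C%C.
  have rr : Num.conj (r%:C%C : C) = r%:C%C by exact: conjc_real.
  have two : (2 : R)%:C%C = 2 :> C by rewrite rmorph_nat.
  rewrite rmorphN rmorphM /= rr rmorphD rmorphB /= !rmorphM /= two.
  have -> : (nrm c)%:C%C * (nrm c)%:C%C = c * Num.conj c :> C.
    by rewrite mulC_conj rmorphXn.
  ring.
by [].
Qed.

(** Take t = s in the hypothesis. *)
Lemma bnorm_le s (M : R) : 0 <= M ->
  (forall t, nrm (bform s t) <= M * bnorm t) -> bnorm s <= M.
Proof.
move=> M0 /(_ s); rewrite bform_bnorm nrm_real ger0_norm ?sqr_ge0// expr2 => h.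
rewrite leNgt; apply/negP => Ms.
have : M * bnorm s < bnorm s * bnorm s by rewrite ltr_pM2r//; lra.
lra.
Qed.

Lemma bnorm_lincomb a s t : bnorm (lincomb a s t) <= nrm a * bnorm s + bnorm t.
Proof.
apply: bnorm_le; first by rewrite addr_ge0 ?mulr_ge0 ?nrm_ge0 ?bnorm_ge0.
move=> u; rewrite bform_lincombl; apply: le_trans (nrmD _ _) _.
rewrite nrmM mulrDl lerD ?bform_cauchy_schwarz// -mulrA ler_wpM2l ?nrm_ge0//.
exact: bform_cauchy_schwarz.
Qed.

(** The functional f - ev (sigma n) tends to 0 in the norm dual to [bnorm].
    Stated in this way, the representation determines f and the limits of
    inner products without any choice of a norm on functions. *)
Definition represents (sigma : nat -> comb) f := forall e : R, 0 < e ->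
  exists N, forall n, (N <= n)%N ->
  forall t, nrm (pair t f - bform (sigma n) t) <= e * bnorm t.

Definition cauchy_comb (sigma : nat -> comb) := forall e : R, 0 < e ->
  exists N, forall m n, (N <= m)%N -> (N <= n)%N ->
  bnorm (lincomb (-1) (sigma n) (sigma m)) <= e.

Lemma represents_ev s : represents (fun=> s) (ev s).
Proof.
move=> e e0; exists 0%N => n _ t; rewrite -/(bform s t) subrr nrm0.
by rewrite mulr_ge0 ?bnorm_ge0// ltW.
Qed.

Lemma represents_lincomb a sigma tau f g : represents sigma f ->
  represents tau g ->
  represents (fun n => lincomb a (sigma n) (tau n)) (a *: f + g).
Proof.
move=> sf tg e e0; have e1 : 0 < e / (2 * (nrm a + 1)).
  by rewrite divr_gt0// mulr_gt0// ltr_wpDl ?nrm_ge0.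
have e2 : 0 < e / 2 by lra.
have [N hN] := sf _ e1; have [M hM] := tg _ e2; exists (maxn N M) => n.
rewrite geq_max => /andP[/hN{}hN /hM{}hM] t; rewrite pairDr bform_lincombl.
have -> : a * pair t f + pair t g - (a * bform (sigma n) t + bform (tau n) t) =
   a * (pair t f - bform (sigma n) t) + (pair t g - bform (tau n) t) by ring.
apply: le_trans (nrmD _ _) _; rewrite nrmM.
suff : nrm a * nrm (pair t f - bform (sigma n) t) <= e / 2 * bnorm t.
  by have := hM t; lra.
apply: (@le_trans _ _ ((nrm a + 1) * (e / (2 * (nrm a + 1)) * bnorm t))).
  by apply: ler_pM; rewrite ?nrm_ge0// lerDl.
have : nrm a + 1 != 0 by rewrite lt0r_neq0// ltr_wpDl ?nrm_ge0.
move=> ?; rewrite le_eqVlt; apply/orP; left; apply/eqP; field => //.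
Qed.

Lemma represents_cauchy sigma f : represents sigma f -> cauchy_comb sigma.
Proof.
move=> sf e e0; have e2 : 0 < e / 2 by lra.
have [N hN] := sf _ e2; exists N => m n /hN hm /hN hn.
apply: bnorm_le; first lra; move=> t; rewrite bform_lincombl.
have -> : -1 * bform (sigma n) t + bform (sigma m) t =
  (pair t f - bform (sigma n) t) - (pair t f - bform (sigma m) t) by ring.
by apply: le_trans (nrmD _ _) _; rewrite nrmN; have := hm t; have := hn t; lra.
Qed.

Lemma cauchy_bounded sigma : cauchy_comb sigma ->
  exists M N, 0 <= M /\ forall n, (N <= n)%N -> bnorm (sigma n) <= M.
Proof.
move=> /(_ _ ltr01)[N hN]; exists (1 + bnorm (sigma N)), N.
split=> [|n Nn]; first by rewrite addr_ge0 ?bnorm_ge0.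
have := hN _ _ Nn (leqnn N); set u := lincomb _ _ _ => hu.
apply: bnorm_le; first by rewrite addr_ge0 ?bnorm_ge0.
move=> t; have -> : bform (sigma n) t = bform u t + bform (sigma N) t.
  by rewrite /u bform_lincombl; ring.
apply: le_trans (nrmD _ _) _; rewrite mulrDl lerD ?bform_cauchy_schwarz//.
apply: le_trans (bform_cauchy_schwarz _ _) _.
by rewrite ler_wpM2r ?bnorm_ge0.
Qed.

Lemma bform_diff s t s' t' (M M' d : R) : 0 <= M -> 0 <= d ->
  bnorm s <= M -> bnorm t' <= M' ->
  bnorm (lincomb (-1) s' s) <= d -> bnorm (lincomb (-1) t' t) <= d ->
  nrm (bform s t - bform s' t') <= d * (M + M').
Proof.
move=> M0 d0 sM t'M' sd td.
have -> : bform s t - bform s' t' =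
    bform s (lincomb (-1) t' t) + bform (lincomb (-1) s' s) t'.
  by rewrite bform_lincombr bform_lincombl rmorphN rmorph1; ring.
apply: le_trans (nrmD _ _) _; rewrite mulrDr (mulrC d M).
by apply: lerD; apply: le_trans (bform_cauchy_schwarz _ _) _;
  apply: ler_pM; rewrite ?bnorm_ge0.
Qed.

Lemma bform_lim_diff sigma tau sigma' tau' :
  cauchy_comb sigma -> cauchy_comb tau' ->
  (forall e : R, 0 < e -> exists N, forall n, (N <= n)%N ->
    bnorm (lincomb (-1) (sigma' n) (sigma n)) <= e) ->
  (forall e : R, 0 < e -> exists N, forall n, (N <= n)%N ->
    bnorm (lincomb (-1) (tau' n) (tau n)) <= e) ->
  forall e : R, 0 < e -> exists N, forall n, (N <= n)%N ->
    nrm (bform (sigma n) (tau n) - bform (sigma' n) (tau' n)) < e.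
Proof.
move=> /cauchy_bounded[M [N [M0 hN]]] /cauchy_bounded[M' [N' [M'0 hN']]] ds dt e e0.
have d0 : 0 < e / (M + M' + 1) by rewrite divr_gt0//; lra.
have [K hK] := ds _ d0; have [K' hK'] := dt _ d0.
exists (maxn (maxn N N') (maxn K K')) => n.
rewrite !geq_max => /andP[/andP[/hN{}hN /hN'{}hN'] /andP[/hK{}hK /hK'{}hK']].
apply: le_lt_trans (bform_diff M0 (ltW d0) hN hN' hK hK') _.
by rewrite mulrAC ltr_pdivrMr; [rewrite ltr_pM2l//|]; lra.
Qed.

Lemma represents_diff sigma sigma' f : represents sigma f -> represents sigma' f ->
  forall e : R, 0 < e -> exists N, forall n, (N <= n)%N ->
    bnorm (lincomb (-1) (sigma' n) (sigma n)) <= e.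
Proof.
move=> sf s'f e e0; have e2 : 0 < e / 2 by lra.
have [N hN] := sf _ e2; have [N' hN'] := s'f _ e2.
exists (maxn N N') => n; rewrite geq_max => /andP[/hN{}hN /hN'{}hN'].
apply: bnorm_le; first lra; move=> t; rewrite bform_lincombl.
have -> : -1 * bform (sigma' n) t + bform (sigma n) t =
  (pair t f - bform (sigma' n) t) - (pair t f - bform (sigma n) t) by ring.
by apply: le_trans (nrmD _ _) _; rewrite nrmN; have := hN t; have := hN' t; lra.
Qed.

Lemma bform_cvg sigma tau f g : represents sigma f -> represents tau g ->
  exists l : C, bform (sigma n) (tau n) @[n --> \oo] --> l.
Proof.
move=> sf tg; apply: cauchy_seq_cvgC => e e0.
have cs := represents_cauchy sf; have ct := represents_cauchy tg.
have [M [N [M0 hN]]] := cauchy_bounded cs.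
have [M' [N' [M'0 hN']]] := cauchy_bounded ct.
have d0 : 0 < e / (M + M' + 1) by rewrite divr_gt0//; lra.
have [K hK] := cs _ d0; have [K' hK'] := ct _ d0.
exists (maxn (maxn N N') (maxn K K')) => m n.
rewrite !geq_max => /andP[/andP[Nm _] /andP[Km K'm]] /andP[/andP[_ N'n] /andP[Kn K'n]].
apply: le_lt_trans (bform_diff M0 (ltW d0) (hN _ Nm) (hN' _ N'n)
  (hK _ _ Km Kn) (hK' _ _ K'm K'n)) _.
by rewrite mulrAC ltr_pdivrMr; [rewrite ltr_pM2l//|]; lra.
Qed.

(** The pointwise limit exists because evaluation at x is the form against the
    point x; the Cauchy estimate then passes to the limit. *)
Lemma cauchy_comb_represents sigma : cauchy_comb sigma ->
  exists f, represents sigma f.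
Proof.
move=> cs.
have ex x : exists l : C, ev (sigma n) x @[n --> \oo] --> l.
  apply: cauchy_seq_cvgC => e e0.
  have evE s : ev s x = bform s [:: (1, x)] by rewrite /bform /pair big_seq1 rmorph1 mul1r.
  have d0 : 0 < e / (bnorm [:: (1, x)] + 1) by rewrite divr_gt0// ltr_wpDl ?bnorm_ge0.
  have [N hN] := cs _ d0; exists N => m n Nm Nn; rewrite !evE.
  have -> : bform (sigma m) [:: (1, x)] - bform (sigma n) [:: (1, x)] =
     bform (lincomb (-1) (sigma n) (sigma m)) [:: (1, x)] by rewrite bform_lincombl; ring.
  apply: le_lt_trans (bform_cauchy_schwarz _ _) _.
  have := hN _ _ Nm Nn; rewrite ler_pdivlMr ?ltr_wpDl ?bnorm_ge0// mulrDr mulr1.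
  set u := bnorm (lincomb _ _ _) => h; have : 0 <= u by exact: bnorm_ge0.
  rewrite le_eqVlt => /orP[/eqP<-|]; last by lra.
  by rewrite mul0r.
have [f fP] := choice ex; exists f => e e0; have e2 : 0 < e / 2 by lra.
have [N hN] := cs _ e0; exists N => n Nn t.
have cvt : pair t (ev (sigma m)) @[m --> \oo] --> pair t f.
  by apply: cvgC_sum => q; apply: cvgM; [exact: cvg_cst|exact: fP].
apply: le_eps => d d0; have [N' hN'] := (cvg_nrmP _ _).1 cvt _ d0.
pose m := maxn N N'.
apply: le_trans (nrm_tri _ (bform (sigma m) t) _) _.
have := hN' m (leq_maxr _ _); rewrite nrmC.
have := hN m n (leq_maxl _ _) Nn => hmn.
have -> : bform (sigma m) t - bform (sigma n) t =
     bform (lincomb (-1) (sigma n) (sigma m)) t by rewrite bform_lincombl; ring.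
have := bform_cauchy_schwarz (lincomb (-1) (sigma n) (sigma m)) t.
have : bnorm (lincomb (-1) (sigma n) (sigma m)) * bnorm t <= e * bnorm t.
  by rewrite ler_wpM2r ?bnorm_ge0.
rewrite /bform; lra.
Qed.

Definition in_rkhs f := exists sigma, represents sigma f.
Definition rkhs_pred : {pred X -> C} := fun f => `[< in_rkhs f >].

Lemma rkhs_submod_closed : submod_closed rkhs_pred.
Proof.
split=> [|a f g /asboolP[sigma sf] /asboolP[tau tg]]; apply/asboolP.
  exists (fun=> [::]); have -> : 0 = ev [::] by apply/funext => x; rewrite /ev big_nil.
  exact: represents_ev.
by exists (fun n => lincomb a (sigma n) (tau n)); exact: represents_lincomb.
Qed.

HB.instance Definition _ :=
  GRing.isSubmodClosed.Build C (X -> C) rkhs_pred rkhs_submod_closed.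

End Combinations.

Section Rkhs.
Variables (R : realType) (X : Type) (k : psd_kernel R X).
Local Notation C := R[i].

Record rkhs := Rkhs { rkhs_fun :> X -> C ; rkhs_funP : rkhs_fun \in rkhs_pred k }.

HB.instance Definition _ := [isSub for rkhs_fun].
HB.instance Definition _ := [Choice of rkhs by <:].
HB.instance Definition _ := [SubChoice_isSubLmodule of rkhs by <:].

Implicit Types f g : rkhs.

Lemma rkhs_represented f : exists sigma, represents k sigma f.
Proof. exact/asboolP/rkhs_funP. Qed.

Definition approx f : nat -> seq (C * X) := sval (cid (rkhs_represented f)).

Lemma approxP f : represents k (approx f) f.
Proof. exact: svalP (cid (rkhs_represented f)). Qed.

Definition rinner f g : C := limn (fun n => bform k (approx f n) (approx g n)).

(** The limit does not depend on the approximating sequences, from which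
    all algebraic properties of [rinner] follow. *)
Lemma rinner_cvg sigma tau f g : represents k sigma f -> represents k tau g ->
  bform k (sigma n) (tau n) @[n --> \oo] --> rinner f g.
Proof.
move=> sf tg; have cv : bform k (approx f n) (approx g n) @[n --> \oo] --> rinner f g.
  by have [l] := bform_cvg (approxP f) (approxP g) => fgl; apply/cvg_ex; exists l.
apply/cvg_nrmP => e e0; have e2 : 0 < e / 2 by lra.
have [N hN] := (cvg_nrmP _ _).1 cv _ e2.
have [M hM] := bform_lim_diff (represents_cauchy sf) (represents_cauchy (approxP g))
   (represents_diff sf (approxP f)) (represents_diff tg (approxP g)) e2.
exists (maxn N M) => n; rewrite geq_max => /andP[/hN{}hN /hM{}hM].
by apply: le_lt_trans (nrm_tri _ (bform k (approx f n) (approx g n)) _) _; lra.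
Qed.

Lemma represents_lincomb_rkhs a sigma tau f g : represents k sigma f ->
  represents k tau g ->
  represents k (fun n => lincomb a (sigma n) (tau n)) (a *: f + g : rkhs).
Proof. exact: represents_lincomb. Qed.

Lemma rinner_linearl f : GRing.linear_for ( *%R : C -> C -> C) (rinner^~ f).
Proof.
move=> a g h; have H := represents_lincomb_rkhs a (approxP g) (approxP h).
apply: cvg_nrm_uniq (rinner_cvg H (approxP f)) _.
under eq_fun do rewrite bform_lincombl.
by apply: cvgD; [apply: cvgM; [exact: cvg_cst|]|];
  apply: rinner_cvg; exact: approxP.
Qed.

Lemma rinner_conj f g : rinner f g = (-1) ^+ false * Num.conj (rinner g f).
Proof.
rewrite mul1r; apply: cvg_nrm_uniq (rinner_cvg (approxP f) (approxP g)) _.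
under eq_fun do rewrite bform_conj.
by apply: cvg_conjC; apply: rinner_cvg; exact: approxP.
Qed.

Lemma rinner_linearr f : GRing.linear_for (Num.conj \; *%R : C -> C -> C) (rinner f).
Proof.
move=> a g h /=; rewrite rinner_conj mul1r rinner_linearl rmorphD rmorphM /=.
by congr (_ * _ + _); rewrite [RHS]rinner_conj mul1r.
Qed.

Lemma rinner_ge0 f : 0 <= rinner f f.
Proof.
apply: cvgC_ge0 (rinner_cvg (approxP f) (approxP f)) _ => n.
exact: bform_ge0.
Qed.

Definition rnorm f : R := Num.sqrt (complex.Re (rinner f f)).

Lemma rnorm_ge0 f : 0 <= rnorm f. Proof. exact: sqrtr_ge0. Qed.

Lemma rinner_rnorm f : rinner f f = (rnorm f ^+ 2)%:C%C.
Proof. by rewrite sqr_sqrtr ?Re_ge0 ?rinner_ge0// -ge0_ReE ?rinner_ge0. Qed.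

Lemma bnorm_cvg sigma f : represents k sigma f -> forall e : R, 0 < e ->
  exists N, forall n, (N <= n)%N -> `|bnorm k (sigma n) - rnorm f| < e.
Proof.
move=> sf e e0; have e2 : 0 < e ^+ 2 by exact: exprn_gt0.
have [N hN] := (cvg_nrmP _ _).1 (rinner_cvg sf sf) _ e2; exists N => n /hN.
rewrite bform_bnorm rinner_rnorm -raddfB /= nrm_real => h.
set x := bnorm k (sigma n) in h *; set y := rnorm f in h *.
have x0 : 0 <= x by exact: bnorm_ge0.
have y0 : 0 <= y by exact: rnorm_ge0.
rewrite -(@ltr_pXn2r _ 2)// ?nnegrE ?normr_ge0 ?ltW//.
apply: le_lt_trans h; rewrite subr_sqr normrM expr2 ler_wpM2l ?normr_ge0//.
rewrite (ger0_norm (addr_ge0 x0 y0)) ler_norml; apply/andP; split; lra.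
Qed.

Lemma rnormD f g : rnorm (f + g) <= rnorm f + rnorm g.
Proof.
apply: le_eps => e e0; have e3 : 0 < e / 3 by lra.
have H := represents_lincomb_rkhs 1 (approxP f) (approxP g).
rewrite scale1r in H.
have [N1 h1] := bnorm_cvg (approxP f) e3; have [N2 h2] := bnorm_cvg (approxP g) e3.
have [N3 h3] := bnorm_cvg H e3; pose n := maxn N1 (maxn N2 N3).
have add_le (x x' z z' w w' : R) : `|x - x'| < e / 3 -> `|z - z'| < e / 3 ->
    `|w - w'| < e / 3 -> w <= x + z -> w' <= x' + z' + e.
  by rewrite !ltr_norml => /andP[? ?] /andP[? ?] /andP[? ?]; lra.
apply: (add_le _ _ _ _ _ _ (h1 n _) (h2 n _) (h3 n _)); rewrite ?leq_max ?leqnn ?orbT//.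
by have := bnorm_lincomb k 1 (approx f n) (approx g n); rewrite nrm1 mul1r.
Qed.

Lemma ev_in_rkhs s : ev k s \in rkhs_pred k.
Proof. by apply/asboolP; exists (fun=> s); exact: represents_ev. Qed.
Definition rkhs_ev s : rkhs := Rkhs (ev_in_rkhs s).

Lemma pair_cvg f s : bform k (approx f n) s @[n --> \oo] --> pair s f.
Proof.
apply/cvg_nrmP => e e0; have d0 : 0 < e / (bnorm k s + 1).
  by rewrite divr_gt0// ltr_wpDl ?bnorm_ge0.
have [N hN] := approxP f d0; exists N => n /hN /(_ s); rewrite nrmC => h.
apply: le_lt_trans h _; rewrite mulrAC ltr_pdivrMr ?ltr_wpDl ?bnorm_ge0//.
by rewrite ltr_pM2l//; lra.
Qed.

Lemma rinner_ev f s : rinner f (rkhs_ev s) = pair s f.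
Proof.
have := @rinner_cvg _ _ f (rkhs_ev s) (approxP f) (represents_ev k s).
by move/cvg_nrm_uniq; apply; exact: pair_cvg.
Qed.

Lemma rkhs_reproducing f x : rinner f (rkhs_ev [:: (1, x)]) = f x.
Proof. by rewrite rinner_ev /pair big_seq1 rmorph1 mul1r. Qed.

Lemma pair_rnorm f s : nrm (pair s f) <= rnorm f * bnorm k s.
Proof.
apply: le_eps => e e0; have d0 : 0 < e / (bnorm k s + 1) / 2.
  by rewrite !divr_gt0// ltr_wpDl ?bnorm_ge0.
have e2 : 0 < e / 2 by lra.
have [N hN] := bnorm_cvg (approxP f) d0.
have [M hM] := (cvg_nrmP _ _).1 (@pair_cvg f s) _ e2.
have := hN (maxn N M) (leq_maxl _ _); have := hM (maxn N M) (leq_maxr _ _).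
set n := maxn _ _; rewrite nrmC => h1; rewrite ltr_norml => /andP[_ h2].
have := nrmD (pair s f - bform k (approx f n) s) (bform k (approx f n) s); rewrite subrK.
have := bform_cauchy_schwarz k (approx f n) s.
have : bnorm k (approx f n) * bnorm k s <= (rnorm f + e / (bnorm k s + 1) / 2) * bnorm k s.
  by rewrite ler_wpM2r ?bnorm_ge0//; lra.
rewrite mulrDl.
suff : e / (bnorm k s + 1) / 2 * bnorm k s <= e / 2 by lra.
set b := bnorm k s; have b0 : 0 <= b by exact: bnorm_ge0.
rewrite mulrAC ler_pM2r ?invr_gt0// mulrAC ler_pdivrMr ?ltr_wpDl//.
by rewrite ler_wpM2l//; lra.
Qed.

Lemma rnorm0_eq0 f : rnorm f = 0 -> f = 0.
Proof.
move=> f0; apply/val_inj/funext => x /=; apply: nrm_eq0; apply/eqP.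
rewrite eq_le nrm_ge0 andbT; have := pair_rnorm f [:: (1, x)].
by rewrite f0 mul0r /pair big_seq1 rmorph1 mul1r.
Qed.

HB.instance Definition _ := @bilinear_isBilinear.Build C rkhs rkhs C
  *%R (Num.conj \; *%R) rinner (rinner_linearl, rinner_linearr).

HB.instance Definition _ :=
  @isHermitianSesquilinear.Build C rkhs false Num.conj rinner rinner_conj.

Lemma rinner_gt0 f : f != 0 -> 0 < rinner f f.
Proof.
move=> f0; rewrite rinner_rnorm ltcR exprn_gt0// lt_def rnorm_ge0 andbT.
by apply: contra f0 => /eqP/rnorm0_eq0/eqP.
Qed.

HB.instance Definition _ := @isDotProduct.Build C rkhs rinner rinner_gt0.

Lemma rnormZ (a : C) f : rnorm (a *: f) = nrm a * rnorm f.
Proof.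
apply/eqP; rewrite -(@eqrXn2 _ 2)// ?mulr_ge0 ?rnorm_ge0 ?nrm_ge0//; apply/eqP.
apply: (@complexI R); rewrite -rinner_rnorm linearZl_LR linearZr_LR /=.
by rewrite rinner_rnorm mulrA mulC_conj exprMn -rmorphM.
Qed.

Definition rkhs_norm f : C := (rnorm f)%:C%C.

Lemma rkhs_normD f g : rkhs_norm (f + g) <= rkhs_norm f + rkhs_norm g.
Proof. by rewrite /rkhs_norm -rmorphD lecR rnormD. Qed.

Lemma rkhs_normZ a f : rkhs_norm (a *: f) = `|a| * rkhs_norm f.
Proof. by rewrite /rkhs_norm rnormZ rmorphM /= -nrmE. Qed.

Lemma rkhs_norm0_eq0 f : rkhs_norm f = 0 -> f = 0.
Proof. by move=> [] /rnorm0_eq0. Qed.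

HB.instance Definition _ :=
  Lmodule_isNormed.Build C rkhs rkhs_normD rkhs_normZ rkhs_norm0_eq0.

Lemma nrm_rkhs f : nrm f = rnorm f.
Proof. by []. Qed.

Lemma nrm_rkhs_ev s : nrm (rkhs_ev s) = bnorm k s.
Proof. by rewrite nrm_rkhs /rnorm rinner_ev. Qed.

Lemma rkhs_ev_lincomb a s t : rkhs_ev (lincomb a s t) = a *: rkhs_ev s + rkhs_ev t.
Proof. by apply/val_inj; exact: ev_lincomb. Qed.

Lemma rnorm_le f (M : R) : 0 <= M ->
  (forall t, nrm (pair t f) <= M * bnorm k t) -> rnorm f <= M.
Proof.
move=> M0 fM; apply: le_eps => e e0; have e2 : 0 < e / 2 by lra.
have [N hN] := approxP f e2; have [N' hN'] := bnorm_cvg (approxP f) e2.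
pose n := maxn N N'; have := hN' n (leq_maxr _ _).
suff : bnorm k (approx f n) <= M + e / 2.
  by rewrite ltr_norml => ? /andP[? ?]; lra.
apply: bnorm_le => [|t]; first lra.
have := hN n (leq_maxl _ _) t; have := fM t.
have := nrmD (pair t f) (- (pair t f - bform k (approx f n) t)).
rewrite nrmN opprB addrC subrK mulrDl; lra.
Qed.

(** The definition of [represents] bounds the norm of the difference by
    duality ([rnorm_le]). *)
Lemma rkhs_approx sigma f : represents k sigma f -> forall e : R, 0 < e ->
  exists N, forall n, (N <= n)%N -> nrm (f - rkhs_ev (sigma n)) <= e.
Proof.
move=> sf e e0; have [N hN] := sf _ e0; exists N => n Nn.
apply: rnorm_le => [|t]; first exact: ltW.
by have := hN n Nn t; rewrite -pairBr.
Qed.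

(** Replace a Cauchy filter by a Cauchy sequence of finite combinations, which
    represents an element of the space. *)
Lemma rkhs_complete (F : set_system rkhs) : ProperFilter F -> cauchy F -> cvg F.
Proof.
move=> FF /cauchyP cF.
have close n : exists s, F (ball (rkhs_ev s) ((n.+1%:R^-1 : R)%:C%C : C)).
  have d0 : 0 < (n.+1%:R^-1 / 2 : R) by rewrite divr_gt0// invr_gt0 ltr0n.
  have d0C : 0 < (n.+1%:R^-1 / 2)%:C%C :> C by rewrite ltcR.
  have [f Ff] := cF _ d0C.
  have [M hM] := rkhs_approx (approxP f) d0; exists (approx f M).
  apply: filterS Ff => g /ball_nrmP fg; apply/ball_nrmP.
  apply: le_lt_trans (nrm_tri _ f _) _; rewrite nrmC.
  by rewrite [ltRHS]splitr; apply: ler_ltD; [exact: hM M (leqnn M)|exact: fg].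
have [sigma sigmaP] := choice close.
have csigma : cauchy_comb k sigma.
  move=> e e0; have e2 : 0 < e / 2 by lra.
  have [N hN] := inv_succ_lt e2; exists N => m n Nm Nn.
  rewrite -nrm_rkhs_ev rkhs_ev_lincomb scaleN1r addrC.
  have [g [/ball_nrmP mg /ball_nrmP ng]] := filter_ex (filterI (sigmaP m) (sigmaP n)).
  apply: le_trans (nrm_tri _ g _) _; rewrite (nrmC g) [e]splitr; apply: lerD.
    exact/ltW/(lt_trans mg)/hN.
  exact/ltW/(lt_trans ng)/hN.
have [f0 sf0] := cauchy_comb_represents csigma.
have f0P : f0 \in rkhs_pred k by apply/asboolP; exists sigma.
apply/cvg_ex; exists (Rkhs f0P).
apply/cvgrPdist_lt => _ /gt0_complexP[e e0 ->]; have e2 : 0 < e / 2 by lra.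
have [N hN] := inv_succ_lt e2.
have [M hM] := @rkhs_approx sigma (Rkhs f0P) sf0 _ e2.
apply: filterS (sigmaP (maxn N M)) => g /ball_nrmP sg.
rewrite nrmE ltcR; apply: le_lt_trans (nrm_tri _ (rkhs_ev (sigma (maxn N M))) _) _.
rewrite [e]splitr; apply: ler_ltD; first exact/hM/leq_maxr.
exact/(lt_trans sg)/hN/leq_maxl.
Qed.

HB.instance Definition _ := Uniform_isComplete.Build rkhs rkhs_complete.

Lemma rkhs_norm_inner f : `|f| ^+ 2 = rinner f f.
Proof. by rewrite nrmE -rmorphXn /= -rinner_rnorm. Qed.

Definition rkhs_hilbert : hilbert C := @Hilbert C rkhs rinner rkhs_norm_inner.

End Rkhs.

(** * Bounded operators determined on generators *)

Section Extension.
Variable R : realType.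
Local Notation C := R[i].

Lemma image_choice (J I V : Type) (E : set I) (g : I -> V) (v : J -> V) :
  (forall j, (g @` E) (v j)) -> exists h : J -> I, forall j, E (h j) /\ g (h j) = v j.
Proof.
move=> vE; suff /choice[h hP] : forall j, exists i, E i /\ g i = v j by exists h.
by move=> j; have [i Ei gi] := vE j; exists i.
Qed.

Lemma lin_span_lincomb (V : lmodType C) (E : set V) (a : C) (x y : V) :
  lin_span E x -> lin_span E y -> lin_span E (a *: x + y).
Proof.
move=> [n [c [v [Ev ->]]]] [m [d [w [Ew ->]]]].
exists (n + m)%N, (fun i => match fintype.split i with inl j => a * c j | inr j => d j end),
  (fun i => match fintype.split i with inl j => v j | inr j => w j end).
split=> [i|]; first by case: fintype.split.
rewrite big_split_ord /= scaler_sumr; congr (_ + _); apply: eq_bigr => i _.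
  by rewrite (unsplitK (inl i)) scalerA.
by rewrite (unsplitK (inr i)).
Qed.

Lemma lin_span0 (V : lmodType C) (E : set V) : lin_span E 0.
Proof. by exists 0%N, (fun=> 0), (fun=> 0); split=> [[]//|]; rewrite big_ord0. Qed.

Lemma lin_span_gen (V : lmodType C) (E : set V) (x : V) : E x -> lin_span E x.
Proof. by move=> Ex; exists 1%N, (fun=> 1), (fun=> x); split=> //; rewrite big_ord1 scale1r. Qed.

Lemma nrm_lincomb_lt (V : normedModType C) (a : C) (u v u' v' : V) (e : R) :
  nrm (u - u') < e / (2 * (nrm a + 1)) -> nrm (v - v') < e / 2 ->
  nrm (a *: u + v - (a *: u' + v')) < e.
Proof.
move=> uu' vv'; have -> : a *: u + v - (a *: u' + v') = a *: (u - u') + (v - v').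
  by rewrite scalerBr opprD addrACA.
have a1 : 0 < nrm a + 1 by rewrite ltr_wpDl ?nrm_ge0.
apply: le_lt_trans (nrmD _ _) _; rewrite nrmZ.
suff : nrm a * nrm (u - u') <= e / 2 by lra.
apply: (@le_trans _ _ ((nrm a + 1) * (e / (2 * (nrm a + 1))))).
  by apply: ler_pM; rewrite ?nrm_ge0 ?ltW// ltrDl.
by rewrite le_eqVlt; apply/orP; left; apply/eqP; field; exact: lt0r_neq0.
Qed.

Lemma closure_lin_span_lincomb (V : normedModType C) (E : set V) (a : C) (x y : V) :
  closure (lin_span E) x -> closure (lin_span E) y ->
  closure (lin_span E) (a *: x + y).
Proof.
move=> /closure_nrmP clx /closure_nrmP cly; apply/closure_nrmP => e e0.
have d0 : 0 < e / (2 * (nrm a + 1)).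
  by rewrite divr_gt0// mulr_gt0// ltr_wpDl ?nrm_ge0.
have e2 : 0 < e / 2 by lra.
have [x' Ex' xx'] := clx _ d0; have [y' Ey' yy'] := cly _ e2.
exists (a *: x' + y'); first exact: lin_span_lincomb.
exact: nrm_lincomb_lt.
Qed.

Lemma closure_lin_span_sub (V : normedModType C) (E : set V) (W : set V) :
  E `<=` closure (lin_span W) -> lin_span E `<=` closure (lin_span W).
Proof.
move=> EW _ [n [c [v [Ev ->]]]]; elim/big_ind: _ => [|x y Wx Wy|i _].
- by apply: subset_closure; exact: lin_span0.
- by rewrite -[x]scale1r; exact: closure_lin_span_lincomb.
- rewrite -[c i *: v i]addr0; apply: closure_lin_span_lincomb; first exact/EW/Ev.
  by apply: subset_closure; exact: lin_span0.
Qed.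

Section BoundedExtension.
Variables (V : completeNormedModType C) (I : Type) (E : set I) (t s : I -> V).
Variable M : R.
Hypothesis M0 : 0 <= M.

Let pairs : set (V * V)%type := [set (t i, s i) | i in E].
Let W := closure (lin_span [set t i | i in E]).

Hypothesis st : forall p, lin_span pairs p -> nrm p.2 <= M * nrm p.1.
Hypothesis sW : forall i, E i -> W (s i).

Let graph (x x' : V) := forall e : R, 0 < e ->
  exists2 p, lin_span pairs p & nrm (x - p.1) < e /\ nrm (x' - p.2) < e.

Let M1 : 0 < M + 1. Proof. by rewrite ltr_wpDl. Qed.

Let graph_bound x x' : graph x x' -> nrm x' <= M * nrm x.
Proof.
move=> g; apply: le_eps => e e0.
have d0 : 0 < e / (M + 1) by rewrite divr_gt0// ?mulr_gt0.
have [p sp [xp x'p]] := g _ d0; have := st sp.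
have := nrm_tri x' p.2 0; have := nrm_tri p.1 x 0; rewrite !subr0 nrmC => h1 h2 h3.
have : M * nrm p.1 <= M * (nrm x + e / (M + 1)) by rewrite ler_wpM2l//; lra.
have : (M + 1) * (e / (M + 1)) = e by field; exact: lt0r_neq0.
rewrite mulrDr mulrDl; lra.
Qed.

Let graph_lincomb a x y x' y' : graph x x' -> graph y y' ->
  graph (a *: x + y) (a *: x' + y').
Proof.
move=> gx gy e e0; have d0 : 0 < e / (2 * (nrm a + 1)).
  by rewrite divr_gt0// mulr_gt0// ltr_wpDl ?nrm_ge0.
have e2 : 0 < e / 2 by lra.
have [p sp [xp x'p]] := gx _ d0; have [q sq [yq y'q]] := gy _ e2.
exists (a *: p + q); first exact: lin_span_lincomb.
by split; apply: nrm_lincomb_lt.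
Qed.

Let graph_total x : W x -> exists x', graph x x'.
Proof.
move=> /closure_nrmP clx.
have approx n : exists p, lin_span pairs p /\ nrm (x - p.1) < n.+1%:R^-1.
  have d0 : 0 < (n.+1%:R^-1 : R) by rewrite invr_gt0 ltr0n.
  have [_ [m [c [v [Ev ->]]]] xv] := clx _ d0.
  have [j jP] := image_choice Ev.
  exists (\sum_i c i *: ((t (j i), s (j i)) : V * V)); split.
    by exists m, c, (fun i => (t (j i), s (j i))); split=> // i; exists (j i) => //; case: (jP i).
  rewrite (@big_morph _ _ (fun p : V * V => p.1) 0 +%R)//=.
  by under eq_bigr do rewrite (jP _).2.
have [p pP] := choice approx.
have [x' px'] : exists l : V, (p n).2 @[n --> \oo] --> l.
  apply: cauchy_seq_cvg => e e0.
  have d0 : 0 < e / (2 * (M + 1)) by rewrite divr_gt0// ?mulr_gt0.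
  have [N hN] := inv_succ_lt d0; exists N => m n /hN hm /hN hn.
  have H : lin_span pairs (-1 *: p n + p m).
    by apply: lin_span_lincomb; [case: (pP n)|case: (pP m)].
  have h : nrm ((p m).2 - (p n).2) <= M * nrm ((p m).1 - (p n).1).
    by have := st H; rewrite scaleN1r addrC.
  apply: le_lt_trans h _; have [_ pm] := pP m; have [_ pn] := pP n.
  have := nrm_tri (p m).1 x (p n).1; rewrite (nrmC (p m).1 x) => h2.
  have : M * nrm ((p m).1 - (p n).1) <= M * (e / (M + 1)).
    have : e / (M + 1) = 2 * (e / (2 * (M + 1))) by field; exact: lt0r_neq0.
    move=> h3; rewrite ler_wpM2l// h3; set d := e / (2 * _) in hm hn *.
    by have := lt_trans pm hm; have := lt_trans pn hn; move: h2; lra.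
  have : (M + 1) * (e / (M + 1)) = e by field; exact: lt0r_neq0.
  have : 0 < e / (M + 1) by rewrite divr_gt0// ?mulr_gt0.
  rewrite mulrDl; lra.
exists x' => e e0; have [N hN] := inv_succ_lt e0.
have [N' hN'] := (cvg_nrmP _ _).1 px' _ e0.
pose n := maxn N N'; exists (p n); first by case: (pP n).
split; first by have [_ /lt_trans] := pP n; apply; exact: hN (leq_maxl _ _).
by rewrite nrmC; exact: hN' (leq_maxr _ _).
Qed.

Let graph_range x x' : graph x x' -> W x'.
Proof.
move=> g; apply/closure_nrmP => e e0; have e2 : 0 < e / 2 by lra.
have [p [n [c [v [Ev ->]]]] [_ x'p]] := g _ e2.
move: x'p; rewrite (@big_morph _ _ (fun p : V * V => p.2) 0 +%R)//= => x'p.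
have /closure_nrmP/(_ _ e2)[y sy py] : W (\sum_i c i *: (v i).2).
  apply: (@closure_lin_span_sub _ (s @` E)) => [_ [i Ei <-]|]; first exact: sW.
  by exists n, c, (fun i => (v i).2); split=> // i; have [j Ej <-] := Ev i; exists j.
by exists y => //; apply: le_lt_trans (nrm_tri _ _ _) _; move: x'p py; lra.
Qed.

Let graph_uniq x x' x'' : graph x x' -> graph x x'' -> x' = x''.
Proof.
move=> g g'; have := graph_bound (graph_lincomb (-1) g g').
rewrite !scaleN1r addNr nrm0 mulr0 => h; apply/eqP; rewrite eq_sym -subr_eq0 addrC.
by apply/eqP/nrm_eq0/eqP; rewrite eq_le nrm_ge0 andbT.
Qed.

(** The closure of the graph on the span of the generators is again the graph
    of a linear map: the bound M makes it single-valued, and completeness makes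
    it defined on the whole of W. *)
Lemma bounded_extension : exists B : V -> V, bounded_operator W B /\
  forall i, E i -> B (t i) = s i.
Proof.
pose B x := xget 0 (graph x).
have BP x : W x -> graph x (B x).
  by move=> /graph_total[x' gx']; rewrite /B; case: xgetP => [_ -> //|/(_ x')].
exists B; split; first split.
- by move=> x /BP/graph_range.
- move=> a x y Wx Wy; apply: graph_uniq (graph_lincomb a (BP _ Wx) (BP _ Wy)).
  by apply: BP; exact: closure_lin_span_lincomb.
- exists (M%:C%C) => x /BP/graph_bound; rewrite !nrmE -rmorphM lecR.
  by [].
move=> i Ei; have Wi : W (t i) by apply/subset_closure/lin_span_gen; exists i.
apply: graph_uniq (BP _ Wi) _ => e e0; exists (t i, s i).
  by apply: lin_span_gen; exists i.
by rewrite /= !subrr !nrm0.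
Qed.

End BoundedExtension.
End Extension.

Section BoundedOperators.
Variables (R : realType) (V : normedModType R[i]) (W : set V).
Local Notation C := R[i].

(** The bound M of [bounded_operator] may be any complex number; its
    modulus is then also a bound. *)
Lemma bounded_operatorP (B : V -> V) : bounded_operator W B <->
  [/\ forall x, W x -> W (B x),
      forall a x y, W x -> W y -> B (a *: x + y) = a *: B x + B y
    & exists2 M : R, 0 <= M & forall x, W x -> nrm (B x) <= M * nrm x].
Proof.
split=> -[WB linB]; last first.
  move=> [M M0 BM]; split=> //; exists M%:C%C => x /BM.
  by rewrite !nrmE -rmorphM lecR.
move=> [M BM]; split=> //; exists (nrm M); rewrite ?nrm_ge0// => x /BM BMx.
have Mx0 : 0 <= M * `|x| by apply: le_trans BMx.
rewrite -lecR rmorphM /= -!nrmE; apply: le_trans BMx _.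
by rewrite -[leLHS]ger0_norm// normrM normr_id.
Qed.

Lemma bounded_operator_comp (B B' : V -> V) : bounded_operator W B ->
  bounded_operator W B' -> bounded_operator W (B \o B').
Proof.
move=> /bounded_operatorP[WB linB [M M0 BM]] /bounded_operatorP[WB' linB' [M' M'0 BM']].
apply/bounded_operatorP; split=> /=.
- by move=> x /WB'/WB.
- by move=> a x y Wx Wy; rewrite linB' ?linB//; exact: WB'.
- exists (M * M') => [|x Wx]; first exact: mulr_ge0.
  by apply: le_trans (BM _ (WB' _ Wx)) _; rewrite -mulrA ler_wpM2l ?BM'.
Qed.

End BoundedOperators.

(** * Positive kernels and finite-dimensional Hilbert spaces *)

Section PositiveKernels.
Variables (R : realType) (X : Type).
Local Notation C := R[i].

(** The double sum is a sum over i of squared moduli. *)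
Lemma gram_psd (J : Type) (r : seq J) (g : J -> X -> C) :
  psd (fun x y => \sum_(i <- r) g i x * Num.conj (g i y)).
Proof.
move=> s; have -> : \sum_(p <- s) \sum_(q <- s)
      p.1 * Num.conj q.1 * (\sum_(i <- r) g i p.2 * Num.conj (g i q.2)) =
    \sum_(i <- r) (\sum_(p <- s) p.1 * g i p.2) * Num.conj (\sum_(p <- s) p.1 * g i p.2).
  under eq_bigr do [under eq_bigr do rewrite mulr_sumr; rewrite exchange_big /=].
  rewrite exchange_big; apply: eq_bigr => i _ /=.
  rewrite mulr_suml; apply: eq_bigr => p _; rewrite rmorph_sum mulr_sumr.
  by apply: eq_bigr => q _; rewrite rmorphM /=; ring.
by apply: sumr_ge0 => i _; rewrite mulC_conj ler0c sqr_ge0.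
Qed.

(** The double sum splits over the classes, each of which contributes the
    squared modulus of a sum of coefficients.  A partial equivalence relation
    is enough: points not related to themselves contribute nothing. *)
Lemma psd_equivalence (E : X -> X -> Prop) :
  (forall x y, E x y -> E y x) -> (forall x y z, E x y -> E y z -> E x z) ->
  psd (fun x y => `[< E x y >]%:R : C).
Proof.
move=> Esym Etrans s; elim: {s}(size s) {-2}s (leqnn (size s)) => [|n IH] [|p0 s'] //=;
  rewrite ?big_nil//= ltnS => szs; set s := p0 :: s'.
pose F (p q : C * X) := p.1 * Num.conj q.1 * `[< E p.2 q.2 >]%:R.
rewrite -/(F _ _).
have [E0|nE0] := pselect (E p0.2 p0.2); last first.
  have F0 (p q : C * X) : ~ E p.2 q.2 -> F p q = 0.
    by move=> nE; rewrite /F asboolF// mulr0.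
  rewrite big_cons [X in X + _]big1 => [|q _]; last first.
    by apply: F0 => Epq; apply: nE0; exact: Etrans Epq (Esym _ _ Epq).
  rewrite add0r (eq_bigr (fun p => \sum_(q <- s') F p q)) => [|p _]; first exact: IH.
  rewrite big_cons [X in X + _]F0 ?add0r// => Epq; apply: nE0.
  exact: Etrans (Esym _ _ Epq) Epq.
pose P (q : C * X) := `[< E p0.2 q.2 >].
have FP (p q : C * X) : P p != P q -> F p q = 0.
  rewrite /F /P => pq; rewrite asboolF ?mulr0// => Epq; move/eqP: pq; apply.
  apply/asbool_equiv_eq; split=> [Ep|Eq]; first exact: Etrans Ep Epq.
  exact: Etrans Eq (Esym _ _ Epq).
have splitF b : \sum_(p <- s | P p == b) \sum_(q <- s) F p q =
    \sum_(p <- s | P p == b) \sum_(q <- s | P q == b) F p q.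
  apply: eq_bigr => p /eqP Pp; rewrite [LHS](bigID (fun q => P q == b))/=.
  rewrite [X in _ + X]big1 ?addr0// => q Pq; apply: FP.
  by rewrite Pp eq_sym.
rewrite (bigID (fun p => P p == true))/= splitF addr_ge0//.
  have -> : \sum_(p <- s | P p == true) \sum_(q <- s | P q == true) F p q =
      (\sum_(p <- s | P p == true) p.1) * Num.conj (\sum_(p <- s | P p == true) p.1).
    rewrite mulr_suml; apply: eq_bigr => p /eqP/asboolP Pp.
    rewrite rmorph_sum mulr_sumr; apply: eq_bigr => q /eqP/asboolP Pq.
    by rewrite /F asboolT ?mulr1//; exact: Etrans (Esym _ _ Pp) Pq.
  by rewrite mulC_conj ler0c sqr_ge0.
rewrite (eq_bigl (fun p => P p == false)) => [|p]; last by case: (P p).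
rewrite splitF -big_filter; under eq_bigr do rewrite -big_filter.
apply: IH; apply: leq_trans szs; rewrite size_filter /= /P asboolT//=.
exact: count_size.
Qed.

End PositiveKernels.

Section L2.
Variables (R : realType) (T : finType).
Local Notation C := R[i].

Definition delta (x y : T) : C := (x == y)%:R.

Lemma delta_herm x y : delta x y = Num.conj (delta y x).
Proof. by rewrite /delta rmorph_nat eq_sym. Qed.

Lemma delta_psd : psd delta.
Proof.
have -> : delta = (fun x y => \sum_(i : T) delta i x * Num.conj (delta i y)).
  apply/funext => x; apply/funext => y.
  rewrite (bigD1 x)//= big1 ?addr0 => [|i ix].
    by rewrite /delta eqxx mul1r rmorph_nat.
  by rewrite /delta (negPf ix) mul0r.
exact: gram_psd.
Qed.

Definition delta_kernel := PsdKernel delta_herm delta_psd.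
Definition l2 : hilbert C := rkhs_hilbert delta_kernel.

Definition l2_vec (f : T -> C) : l2 := rkhs_ev delta_kernel [seq (f x, x) | x <- enum T].

Lemma l2_vecE f x : (l2_vec f : rkhs delta_kernel) x = f x.
Proof.
rewrite /= /ev big_map big_enum /= (bigD1 x)//= /delta eqxx mulr1.
by rewrite big1 ?addr0// => i /negPf ix; rewrite /delta ix mulr0.
Qed.

Lemma l2_vec_id (f : l2) : l2_vec (f : rkhs delta_kernel) = f.
Proof. by apply/val_inj/funext => x; exact: l2_vecE. Qed.

Lemma l2_inner (f g : l2) : inner l2 f g =
  \sum_x (f : rkhs delta_kernel) x * Num.conj ((g : rkhs delta_kernel) x).
Proof.
rewrite -{1}(l2_vec_id g); rewrite [LHS]rinner_ev /pair big_map big_enum /=.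
by apply: eq_bigr => x _; rewrite mulrC.
Qed.

(** Schur's product theorem, which is immediate when one of the kernels is a
    Gram kernel in coordinates. *)
Lemma psd_mul_l2 (X : Type) (kappa : X -> X -> C) (u : X -> l2) :
  psd kappa -> psd (fun x y => kappa x y * inner l2 (u x) (u y)).
Proof.
move=> kpsd s; pose c x (p : C * X) := p.1 * (u p.2 : rkhs delta_kernel) x.
have -> : \sum_(p <- s) \sum_(q <- s)
      p.1 * Num.conj q.1 * (kappa p.2 q.2 * inner l2 (u p.2) (u q.2))
  = \sum_x \sum_(p <- s) \sum_(q <- s) c x p * Num.conj (c x q) * kappa p.2 q.2.
  rewrite [RHS]exchange_big; apply: eq_bigr => p _ /=.
  rewrite [RHS]exchange_big; apply: eq_bigr => q _ /=.
  rewrite l2_inner !mulr_sumr; apply: eq_bigr => x _.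
  by rewrite /c rmorphM /=; ring.
apply: sumr_ge0 => x _.
have := kpsd [seq (c x p, p.2) | p <- s].
by rewrite big_map; under eq_bigr do rewrite big_map.
Qed.

End L2.

Section HilbertBasics.
Variables (R : realType).
Local Notation C := R[i].

Lemma inner_self (H : hilbert C) (x : H) : inner H x x = (nrm x ^+ 2)%:C%C.
Proof. by rewrite -hilbert_normE nrmE rmorphXn. Qed.

Lemma inner_conj (H : hilbert C) (x y : H) : inner H x y = Num.conj (inner H y x).
Proof. by rewrite hermC mul1r. Qed.

Lemma inner_cauchy_schwarz (H : hilbert C) (x y : H) :
  nrm (inner H x y) <= nrm x * nrm y.
Proof.
have sqrtE (z : H) : nrm z = Num.sqrt (nrm z ^+ 2) by rewrite sqrtr_sqr ger0_norm ?nrm_ge0.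
rewrite (sqrtE x) (sqrtE y); apply: cauchy_schwarz_quadratic; rewrite ?sqr_ge0// => r.
set c := inner H x y; pose v := x - (r%:C%C * c) *: y.
have : 0 <= inner H v v by rewrite inner_self ler0c sqr_ge0.
have rr : Num.conj (r%:C%C : C) = r%:C%C by exact: conjc_real.
have cc : Num.conj c * c = (nrm c ^+ 2)%:C%C by rewrite mulrC mulC_conj.
have dE : Num.conj (r%:C%C * c) * c = (r * nrm c ^+ 2)%:C%C.
  by rewrite (rmorphM Num.conj) /= rr -mulrA cc -rmorphM.
rewrite dnormB dnormZ !inner_self linearZr_LR /= -/c dE.
rewrite nrmE nrmM nrm_real -!(rmorphM, rmorphXn) /= conjCE conjc_real.
rewrite -!(rmorphM, rmorphD, rmorphB) ler0c exprMn real_normK ?num_real// => h.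
by apply: le_trans h _; rewrite le_eqVlt; apply/orP; left; apply/eqP; ring.
Qed.

End HilbertBasics.

Section Gram.
Variables (R : realType) (V : hilbert R[i]).
Local Notation C := R[i].

Lemma inner_suml (I : Type) (r : seq I) (F : I -> V) (y : V) :
  inner V (\sum_(i <- r) F i) y = \sum_(i <- r) inner V (F i) y.
Proof.
by apply: (big_morph (fun x => inner V x y)) => [u v|]; rewrite ?linearDl ?linear0l.
Qed.

Lemma inner_sumr (I : Type) (r : seq I) (F : I -> V) (x : V) :
  inner V x (\sum_(i <- r) F i) = \sum_(i <- r) inner V x (F i).
Proof.
by apply: (big_morph (fun y => inner V x y)) => [u v|]; rewrite ?linearDr ?linear0r.
Qed.

Lemma gram_nrm_eq (n : nat) (c : 'I_n -> C) (u v : 'I_n -> V) :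
  (forall i j, inner V (u i) (u j) = inner V (v i) (v j)) ->
  nrm (\sum_i c i *: u i) = nrm (\sum_i c i *: v i).
Proof.
move=> uv; have E (w : 'I_n -> V) : ((nrm (\sum_i c i *: w i)) ^+ 2)%:C%C =
    \sum_i \sum_j c i * (Num.conj (c j) * inner V (w i) (w j)).
  rewrite -inner_self inner_suml; apply: eq_bigr => i _.
  rewrite inner_sumr; apply: eq_bigr => j _.
  by rewrite linearZl_LR linearZr_LR.
apply/eqP; rewrite -(@eqrXn2 _ 2) ?nrm_ge0//; apply/eqP/(@complexI R).
by rewrite !E; apply: eq_bigr => i _; apply: eq_bigr => j _; rewrite uv.
Qed.

End Gram.

(** * Equivalent sequences and existence of the complete tensor product *)

Section Equivalence.
Variables (R : realType) (H : nat -> hilbert R[i]).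
Local Notation C := R[i].
Implicit Types h f g : forall n, H n.

Definition inner_seq h f : nat -> C := fun n => inner (H n) (h n) (f n).

(** Von Neumann's equivalence of sequences.  Reflexivity at h says that
    sum_n |1 - |h_n|^2| < oo. *)
Definition similar h f := bounded_sums (fun n => nrm (1 - inner_seq h f n)).

Lemma similar_sym h f : similar h f -> similar f h.
Proof.
apply: bounded_sums_le => n; rewrite -nrm_conj rmorphB rmorph1.
by rewrite /inner_seq /= -inner_conj.
Qed.

(** Expand |h_n - f_n|^2. *)
Lemma similar_dist h f : similar h h -> similar f f -> similar h f ->
  bounded_sums (fun n => nrm (h n - f n) ^+ 2).
Proof.
move=> hh ff hf; have fh := similar_sym hf.
apply: bounded_sums_le (bounded_sumsD (bounded_sumsD hh ff) (bounded_sumsD hf fh)) => n.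
rewrite -[leLHS]ger0_norm ?sqr_ge0// -nrm_real -inner_self /inner_seq.
rewrite dnormB /= -inner_conj.
set hhn := inner _ (h n) (h n); set ffn := inner _ (f n) (f n).
set hfn := inner _ (h n) (f n); set fhn := inner _ (f n) (h n).
have -> : hhn + ffn - (hfn + fhn) =
  (1 - hfn) + (1 - fhn) - ((1 - hhn) + (1 - ffn)) by ring.
apply: le_trans (nrmD _ _) _; rewrite nrmN addrC.
by apply: lerD; exact: nrmD.
Qed.

(** 1 - <h,g> = (1 - <h,f>) + (1 - <f,g>) - (1 - <f,f>) - <h-f, g-f>, and the
    last term is summable by Cauchy-Schwarz and [similar_dist]. *)
Lemma similar_trans h f g : similar h h -> similar f f -> similar g g ->
  similar h f -> similar f g -> similar h g.
Proof.
move=> hh ff gg hf fg.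
have dhf := similar_dist hh ff hf.
have dgf := similar_dist gg ff (similar_sym fg).
have := bounded_sumsD (bounded_sumsD (bounded_sumsD hf fg) ff) (bounded_sumsD dhf dgf).
apply: bounded_sums_le => n.
rewrite {1}/inner_seq.
have -> : 1 - inner (H n) (h n) (g n) = (1 - inner_seq h f n) + (1 - inner_seq f g n)
    - (1 - inner_seq f f n) - inner (H n) (h n - f n) (g n - f n).
  by rewrite /inner_seq linearBl !linearBr; ring.
apply: le_trans (nrmD _ _) _; rewrite nrmN; apply: lerD.
  apply: le_trans (nrmD _ _) _; rewrite nrmN; apply: lerD => //.
  exact: nrmD.
apply: le_trans (inner_cauchy_schwarz _ _) _.
set x := nrm _; set y := nrm _; have : 0 <= (x - y) ^+ 2 by exact: sqr_ge0.
have : 0 <= x ^+ 2 by exact: sqr_ge0.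
have : 0 <= y ^+ 2 by exact: sqr_ge0.
rewrite sqrrB; nra.
Qed.

Definition regular_similar h f := [/\ similar h h, similar f f & similar h f].

(** If the norms of h had product 0, then by Cauchy-Schwarz so would the
    inner products with f. *)
Lemma C_sequence_similar h f : C_sequence h -> C_sequence f ->
  qprod (inner_seq h f) != 0 -> similar h h.
Proof.
move=> [a ha] [b fb] q0; have [a0|a0] := eqVneq a 0.
  rewrite a0 in ha; move/eqP: q0; case; apply: qprodE.
  apply: unconditional_prod_dominated0 ha fb => n.
  rewrite !nrmE !nrm_real !ger0_norm ?nrm_ge0//; exact: inner_cauchy_schwarz.
have := bounded_sums_sqr (unconditional_prod_bounded_sums ha a0).
by apply: bounded_sums_le => n; rewrite hilbert_normE.
Qed.

Lemma qprod_neq0_similar h f : C_sequence h -> C_sequence f ->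
  qprod (inner_seq h f) != 0 -> regular_similar h f.
Proof.
move=> Ch Cf q0; split; [exact: C_sequence_similar q0| |exact: qprod_neq0_bounded_sums].
apply: C_sequence_similar Cf Ch _; apply: contra q0 => /eqP q0.
rewrite -conjC_eq0 -conj_qprod -[X in _ == X]q0; apply/eqP; congr qprod.
by apply/funext => n; rewrite /inner_seq -inner_conj.
Qed.

End Equivalence.

Section TensorKernel.
Variables (R : realType) (T : nat -> finType).
Local Notation C := R[i].
Let H n : hilbert C := l2 R (T n).

Definition tensor_fun (h f : C_seq H) : C := qprod (inner_seq (sval h) (sval f)).

Lemma tensor_fun_herm h f : tensor_fun h f = Num.conj (tensor_fun f h).
Proof.
rewrite /tensor_fun -conj_qprod; congr qprod; apply/funext => n.
exact: inner_conj.
Qed.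

(** The kernel is the limit of finite products restricted to an equivalence
    relation: off this relation both sides vanish, and on it the infinite
    product converges. *)
Lemma tensor_fun_psd : psd tensor_fun.
Proof.
pose E (h f : C_seq H) := regular_similar (sval h) (sval f).
have Esym h f : E h f -> E f h
  by move=> [hh ff hf]; split; [exact: ff|exact: hh|exact: similar_sym hf].
have Etrans h f g : E h f -> E f g -> E h g.
  move=> [hh ff hf] [_ gg fg]; split; [exact: hh|exact: gg|].
  exact: similar_trans hh ff gg hf fg.
(* A partial equivalence: sequences outside its domain pair to 0 with all. *)
pose kN N (h f : C_seq H) := `[< E h f >]%:R * \prod_(0 <= n < N) inner_seq (sval h) (sval f) n.
have kN_psd N : psd (kN N).
  elim: N => [|N IH].
    have -> : kN 0%N = (fun h f => `[< E h f >]%:R : C); last exact: psd_equivalence.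
    by apply/funext => h; apply/funext => f; rewrite /kN big_geq// mulr1.
  have -> : kN N.+1 = (fun h f => kN N h f * inner (H N) (sval h N) (sval f N)).
    by apply/funext => h; apply/funext => f; rewrite /kN big_nat_recr//= mulrA.
  exact: psd_mul_l2.
have kN_cvg h f : kN N h f @[N --> \oo] --> tensor_fun h f.
  have [hf|nhf] := pselect (E h f).
    rewrite /kN asboolT//; under eq_fun do rewrite mul1r.
    by apply: qprod_cvg; case: hf.
  have -> : tensor_fun h f = 0.
    apply/eqP; apply/negPn/negP => q0; apply: nhf.
    by apply: qprod_neq0_similar q0; [exact: svalP h|exact: svalP f].
  by rewrite /kN asboolF//; under eq_fun do rewrite mul0r; exact: cvg_cst.
move=> s; apply: (@cvgC_ge0 _ (fun N => \sum_(p <- s) \sum_(q <- s)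
  p.1 * Num.conj q.1 * kN N p.2 q.2)) => [|N]; last exact: kN_psd.
by do 2![apply: cvgC_sum => ?]; apply: cvgM; [exact: cvg_cst|exact: kN_cvg].
Qed.

Definition tensor_kernel := PsdKernel tensor_fun_herm tensor_fun_psd.

Let emb (phi : C_seq H -> C) : rkhs tensor_kernel := insubd (0 : rkhs tensor_kernel) phi.

Let elementaryE (h : C_seq H) :
  elementary_functional (sval h) = ev tensor_kernel [:: (1, h)].
Proof. by apply/funext => f; rewrite /ev big_seq1 mul1r. Qed.

Let span_rkhs phi : functional_span phi -> phi \in rkhs_pred tensor_kernel.
Proof.
move=> [n [c [v [vP ->]]]]; apply: rpred_sum => i _; apply: rpredZ.
by have [h _ <-] := vP i; rewrite elementaryE; exact: ev_in_rkhs.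
Qed.

Let embE phi : functional_span phi -> rkhs_fun (emb phi) = phi.
Proof. by move=> sp; rewrite /emb insubdK// span_rkhs. Qed.

Let span_ev s : functional_span (ev tensor_kernel s).
Proof.
elim: s => [|p s IH].
  have -> : ev tensor_kernel [::] = 0 by apply/funext => f; rewrite /ev big_nil.
  exact: lin_span0.
have -> : ev tensor_kernel (p :: s) = p.1 *: elementary_functional (sval p.2) + ev tensor_kernel s.
  by apply/funext => f; rewrite /ev big_cons.
by apply: lin_span_lincomb => //; apply: lin_span_gen; exists p.2.
Qed.

Let emb_elementary (h : C_seq H) :
  emb (elementary_functional (sval h)) = rkhs_ev tensor_kernel [:: (1, h)].
Proof.
apply/val_inj; rewrite [LHS]embE; first exact: elementaryE.
by apply: lin_span_gen; exists h.
Qed.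

(** The reproducing kernel Hilbert space already consists of functions on
    C-sequences, so the embedding of the span is the identity. *)
Lemma complete_tensor_exists : inhabited (complete_tensor H).
Proof.
constructor; apply: (@CompleteTensor _ H (rkhs_hilbert tensor_kernel) emb).
- move=> a phi psi sphi spsi; apply/val_inj => /=; rewrite embE; last exact: lin_span_lincomb.
  by rewrite -[in LHS](embE sphi) -[in LHS](embE spsi).
- move=> h f; have E : rinner (rkhs_ev tensor_kernel [:: (1, h)])
      (rkhs_ev tensor_kernel [:: (1, f)]) = tensor_fun h f.
    by rewrite rkhs_reproducing [LHS]/= /ev big_seq1 mul1r.
  by rewrite -!emb_elementary in E; exact: E.
- apply/seteqP; split=> // f _; apply/closure_nrmP => e e0.
  have e2 : 0 < e / 2 by lra.
  have [N hN] := rkhs_approx (approxP f) e2.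
  exists (rkhs_ev tensor_kernel (approx f N)).
    exists (ev tensor_kernel (approx f N)); first exact: span_ev.
    by apply/val_inj; rewrite [LHS]embE//; exact: span_ev.
  by apply: le_lt_trans (hN N (leqnn N)) _; lra.
Qed.

End TensorKernel.

(** * Elementary tensors and operators on finitely many factors *)

Section Tensors.
Variables (R : realType) (H : nat -> hilbert R[i]).
Local Notation C := R[i].
Implicit Types h f y : forall n, H n.

Lemma C0_sequenceP h :
  C0_sequence h <-> bounded_sums (fun n => nrm (1 - `|h n|)).
Proof.
split=> [[_ /cvg_bounded_sums//]|bh]; split; last exact/cvg_bounded_sums.
exact: bounded_sums_unconditional_prod.
Qed.

Lemma C0_classP y h : C0_class y h <->
  bounded_sums (fun n => nrm (1 - `|h n|)) /\
  bounded_sums (fun n => nrm (1 - inner (H n) (h n) (y n))).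
Proof.
split=> [[/C0_sequenceP ? /cvg_bounded_sums]|[? ?]] //.
by split; [exact/C0_sequenceP|exact/cvg_bounded_sums].
Qed.

Lemma C0_class_eventually y h f N : (forall n, (N <= n)%N -> h n = f n) ->
  C0_class y h -> C0_class y f.
Proof.
move=> hf /C0_classP[h1 h2]; apply/C0_classP.
split; [apply: bounded_sums_eventually h1 => [n /hf <-//|n]; exact: nrm_ge0|].
by apply: bounded_sums_eventually h2 => [n /hf <-//|n]; exact: nrm_ge0.
Qed.

Lemma C0_class_C_sequence y h : C0_class y h -> C_sequence h.
Proof. by case=> -[]. Qed.

Variable T : complete_tensor H.

Lemma tensor_inner h f : C_sequence h -> C_sequence f ->
  inner T (tensor T h) (tensor T f) = qprod (inner_seq h f).
Proof. by move=> Ch Cf; exact: (ct_emb_inner T (exist _ h Ch) (exist _ f Cf)). Qed.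

Lemma functional_span_elementary h : C_sequence h ->
  functional_span (elementary_functional h).
Proof. by move=> Ch; apply: lin_span_gen; exists (exist _ h Ch). Qed.

Lemma tensor_lincomb (a b : C) h f g : C_sequence f -> C_sequence g ->
  elementary_functional h = a *: elementary_functional f + b *: elementary_functional g ->
  tensor T h = a *: tensor T f + b *: tensor T g.
Proof.
move=> Cf Cg hE; have sp0 : functional_span (0 : C_seq H -> C) by exact: lin_span0.
have emb0 : ct_emb T 0 = 0.
  by have := ct_emb_linear T (-1) sp0 sp0; rewrite scaler0 addr0 scaleN1r addNr.
have sf := functional_span_elementary Cf; have sg := functional_span_elementary Cg.
rewrite /tensor hE ct_emb_linear//; last first.
  by rewrite -[b *: _]addr0; exact: lin_span_lincomb.
by rewrite -[X in _ + ct_emb T X]addr0 ct_emb_linear// emb0 addr0.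
Qed.

End Tensors.

Section PartialOperators.
Variables (R : realType) (E : hilbert R[i]).
Local Notation C := R[i].
Let H := fun _ : nat => E.
Implicit Types h y : forall n, H n.

Definition replace h (i : nat) (u : E) : forall n, H n :=
  fun n => if n == i then u else h n.

(** An infinite product splits off its i-th factor ([qprod_factor]). *)
Lemma elementary_replace_lincomb h i (a b : C) (u v : E) :
  elementary_functional (replace h i (a *: u + b *: v)) =
  a *: elementary_functional (replace h i u) + b *: elementary_functional (replace h i v)
  :> (C_seq H -> C).
Proof.
apply/funext => f; rewrite -[RHS]/(a * _ f + b * _ f) /elementary_functional.
have factor w : qprod (fun n => inner (H n) (replace h i w n) (sval f n)) =
    inner E w (sval f i) * qprod (fun n => if n == i then 1 else inner (H n) (h n) (sval f n)).
  rewrite (qprod_factor _ i) {1}/replace eqxx; congr (_ * qprod _).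
  by apply/funext => n; rewrite /replace; case: eqP.
by rewrite !factor linearDl !linearZl_LR /=; ring.
Qed.

Variables (T : complete_tensor H) (y : forall n, H n).
Let W := incomplete_tensor T y.

Lemma C0_class_replace h i u : C0_class y h -> C0_class y (replace h i u).
Proof.
apply: (@C0_class_eventually _ _ _ _ _ i.+1) => n ni.
by rewrite /replace gtn_eqF.
Qed.

Lemma incomplete_tensor_gen h : C0_class y h -> W (tensor T h).
Proof. by move=> yh; apply/subset_closure/lin_span_gen; exists h. Qed.

(** Applying an isometry in one factor leaves the Gram matrix of elementary
    tensors unchanged, so it extends by [bounded_extension] with bound 1. *)
Lemma factor_isometry_exists (U : E -> E) (i : nat) :
  (forall u v, inner E (U u) (U v) = inner E u v) ->
  exists B, bounded_operator W B /\
    forall h, C0_class y h -> B (tensor T h) = tensor T (replace h i (U (h i))).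
Proof.
move=> isoU; apply: (@bounded_extension _ _ _ (C0_class y) (tensor T)
  (fun h => tensor T (replace h i (U (h i)))) 1) => //; last first.
  by move=> h yh; apply/incomplete_tensor_gen/C0_class_replace.
move=> _ [n [c [v [vP ->]]]]; rewrite mul1r.
have [h hP] := image_choice vP.
have -> : v = fun j => (tensor T (h j), tensor T (replace (h j) i (U (h j i)))).
  by apply/funext => j; case: (hP j).
rewrite (@big_morph _ _ (fun p : T * T => p.1) 0 +%R)//=.
rewrite (@big_morph _ _ (fun p : T * T => p.2) 0 +%R)//=.
rewrite le_eqVlt; apply/orP; left; apply/eqP/gram_nrm_eq => j k.
have [yj _] := hP j; have [yk _] := hP k.
have Cj := C0_class_C_sequence yj; have Ck := C0_class_C_sequence yk.
have Cj' := C0_class_C_sequence (C0_class_replace i (U (h j i)) yj).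
have Ck' := C0_class_C_sequence (C0_class_replace i (U (h k i)) yk).
rewrite (tensor_inner T Cj Ck) (tensor_inner T Cj' Ck'); congr qprod.
by apply/funext => m; rewrite /inner_seq /replace; case: eqP => [->|//]; rewrite isoU.
Qed.

Section CombinationWithIsometry.
Variables (U : E -> E) (a b : C) (A : E -> E).
Hypothesis isoU : forall u v, inner E (U u) (U v) = inner E u v.
Hypothesis AE : forall u, A u = a *: u + b *: U u.

(** Writing the operator on one factor through an isometry avoids a separate
    norm estimate for its action on finite sums of tensors. *)
Lemma factor_operator_exists (i : nat) : exists B, bounded_operator W B /\
  forall h, C0_class y h -> B (tensor T h) = tensor T (replace h i (A (h i))).
Proof.
have [B [/bounded_operatorP[WB linB [M M0 BM]] BU]] := factor_isometry_exists i isoU.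
exists (fun x => a *: x + b *: B x); split; last first.
  move=> h yh; rewrite BU// AE.
  rewrite (tensor_lincomb T _ _ (elementary_replace_lincomb h i a b (h i) (U (h i)))).
  - by congr (_ *: tensor T _ + _); apply/funext => n; rewrite /replace; case: eqP => [->|].
  - exact/C0_class_C_sequence/C0_class_replace.
  - exact/C0_class_C_sequence/C0_class_replace.
apply/bounded_operatorP; split.
- move=> x Wx; have W0 : W 0 by apply/subset_closure/lin_span0.
  have := closure_lin_span_lincomb (a := a) Wx (closure_lin_span_lincomb (a := b) (WB _ Wx) W0).
  by rewrite addr0.
- move=> c u v Wu Wv; rewrite linB// !scalerDr !scalerA (mulrC a) (mulrC b).
  by rewrite -!addrA; congr (_ + _); rewrite addrCA.
- exists (nrm a + nrm b * M) => [|x Wx].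
    by rewrite addr_ge0 ?mulr_ge0 ?nrm_ge0.
  apply: le_trans (nrmD _ _) _; rewrite !nrmZ mulrDl lerD2l -mulrA.
  by rewrite ler_wpM2l ?nrm_ge0 ?BM.
Qed.

Lemma partial_operator_exists (F : {fset nat}) :
  exists B, partial_operator T (fun=> A) y F B.
Proof.
rewrite /partial_operator.
suff [B [bB BE]] : exists B, bounded_operator W B /\ forall h, C0_class y h ->
    B (tensor T h) = tensor T (fun n => if n \in (F : seq nat) then A (h n) else h n).
  by exists B.
elim: (F : seq nat) => [|i l [B [bB BE]]].
  exists id; split => //; apply/bounded_operatorP; split => //.
  by exists 1 => // x _; rewrite mul1r.
have [il|il] := boolP (i \in l).
  exists B; split => // h yh; rewrite BE//; congr tensor; apply/funext => n.
  by rewrite inE; case: eqP => [->|//]; rewrite il.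
have [D [bD DE]] := factor_operator_exists i.
exists (D \o B); split; first exact: bounded_operator_comp.
move=> h yh; rewrite /= BE// DE.
  congr tensor; apply/funext => n; rewrite /replace inE (negPf il).
  by case: eqP => [->|].
apply: (@C0_class_eventually _ _ _ h _ (\max_(j <- l) j).+1) yh => n ln.
rewrite ifN//; apply: contraL ln => nl; rewrite -leqNgt.
exact: leq_bigmax_seq.
Qed.

End CombinationWithIsometry.

End PartialOperators.

(** * The example *)

Section Example.
Variable R : realType.
Local Notation C := R[i].
Let E : hilbert C := l2 R bool.

Definition coord (u : E) (b : bool) : C := (u : rkhs (delta_kernel R bool)) b.

Lemma coord_inj (u v : E) : coord u =1 coord v -> u = v.
Proof. by move=> uv; apply/val_inj/funext => b; exact: uv. Qed.

Lemma coord_vec f b : coord (@l2_vec R bool f) b = f b.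
Proof. exact: l2_vecE. Qed.

Lemma coord_lincomb (a : C) (u v : E) b :
  coord (a *: u + v) b = a * coord u b + coord v b.
Proof. by []. Qed.

Lemma coord_scale (a : C) (u : E) b : coord (a *: u) b = a * coord u b.
Proof. by []. Qed.

Lemma inner_coord (u v : E) : inner E u v =
  coord u true * Num.conj (coord v true) + coord u false * Num.conj (coord v false).
Proof. by rewrite l2_inner big_bool. Qed.

Lemma nrm_coord (u : E) : nrm u ^+ 2 = nrm (coord u true) ^+ 2 + nrm (coord u false) ^+ 2.
Proof.
apply: (@complexI R); rewrite -inner_self inner_coord !mulC_conj.
by rewrite -rmorphD.
Qed.

Definition basis_vec (b : bool) : E := @l2_vec R bool (fun x => (x == b)%:R).

Lemma inner_basis_vec (u : E) b : inner E u (basis_vec b) = coord u b.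
Proof.
rewrite inner_coord !coord_vec; case: b => /=.
  by rewrite rmorph0 rmorph1 mulr0 mulr1 addr0.
by rewrite rmorph0 rmorph1 mulr0 mulr1 add0r.
Qed.

Lemma nrm_basis_vec b : nrm (basis_vec b) = 1.
Proof.
apply/eqP; rewrite -(@eqrXn2 _ 2) ?nrm_ge0// nrm_coord !coord_vec.
by case: b => /=; rewrite nrm0 nrm1 expr0n expr1n ?addr0 ?add0r.
Qed.

(** With basis vectors e_0 at false and e_1 at true, this is diag(1, -1). *)
Definition reflection (u : E) : E :=
  @l2_vec R bool (fun b => if b then - coord u true else coord u false).

(** diag(0, 4).  The factor 4 outweighs the coefficients 2^-k of the series
    on which the strong limit fails. *)
Definition amplification (u : E) : E :=
  @l2_vec R bool (fun b => if b then 4 * coord u true else 0).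

Lemma reflection_isometry (u v : E) : inner E (reflection u) (reflection v) = inner E u v.
Proof. by rewrite !inner_coord !coord_vec rmorphN mulrNN. Qed.

Lemma amplificationE (u : E) : amplification u = 2 *: u + (-2) *: reflection u.
Proof.
apply: coord_inj => b; rewrite coord_lincomb coord_scale !coord_vec.
by case: b; ring.
Qed.

Lemma nrm_amplification (u : E) : nrm (amplification u) = 4 * nrm (coord u true).
Proof.
apply/eqP; rewrite -(@eqrXn2 _ 2) ?mulr_ge0 ?nrm_ge0// nrm_coord !coord_vec.
rewrite nrm0 expr0n addr0 nrmM; apply/eqP; congr ((_ * _) ^+ 2).
have -> : (4 : C) = (4 : R)%:C%C by rewrite rmorph_nat.
by rewrite nrm_real ger0_norm.
Qed.

Lemma coord_le_nrm (u : E) b : nrm (coord u b) <= nrm u.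
Proof.
rewrite -(@ler_pXn2r _ 2) ?nnegrE ?nrm_ge0// nrm_coord.
by case: b; rewrite ?lerDl ?lerDr sqr_ge0.
Qed.

Lemma amplification_bounded : bounded_operator setT amplification.
Proof.
apply/bounded_operatorP; split => // [a u v _ _|].
  apply: coord_inj => b; rewrite coord_lincomb !coord_vec; case: b.
    by rewrite coord_lincomb; ring.
  by rewrite mulr0 addr0.
by exists 4 => // u _; rewrite nrm_amplification ler_wpM2l ?coord_le_nrm.
Qed.

Lemma amplification_basis_vec b :
  amplification (basis_vec b) = if b then 4 *: basis_vec true else 0.
Proof.
apply: coord_inj => c; rewrite coord_vec; case: b; rewrite ?coord_scale ?coord_vec /=.
  by case: c => /=; rewrite ?mulr1 ?mulr0.
by case: c => //; rewrite mulr0.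
Qed.

Let H := fun _ : nat => E.
Let y : forall n, H n := fun=> basis_vec false.

Lemma C0_sequence_y : C0_sequence y.
Proof.
apply/C0_sequenceP; apply: (@bounded_sums_eventually0 _ _ 0%N) => n _.
by rewrite nrmE nrm_basis_vec subrr nrm0.
Qed.

Lemma C0_class_y : C0_class y y.
Proof.
split; first exact: C0_sequence_y.
apply/cvg_bounded_sums; apply: (@bounded_sums_eventually0 _ _ 0%N) => n _.
by rewrite inner_self nrm_basis_vec expr1n subrr nrm0.
Qed.

(** |h_n| and the e_0-component of h_n tend to 1, hence the e_1-component
    tends to 0. *)
Lemma amplification_C0_class (h : forall n, H n) : C0_class y h ->
  exists N, forall n, (N <= n)%N -> nrm (amplification (h n)) <= 1 / 2.
Proof.
move=> /C0_classP[h1 h2].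
(* |e_1 part|^2 = |h_n|^2 - |e_0 part|^2 <= (1 + d)^2 - (1 - d)^2 = 4 d. *)
have [d [d0 d1 dE]] : exists d : R, [/\ 0 < d, d < 1 & 4 * d = (1 / 8) ^+ 2].
  by exists ((1 / 8) ^+ 2 / 4); rewrite expr2; split; lra.
have [N hN] := bounded_sums_small (fun n => nrm_ge0 _) h1 d0.
have [M hM] := bounded_sums_small (fun n => nrm_ge0 _) h2 d0.
exists (maxn N M) => n; rewrite geq_max => /andP[/hN{}hN /hM{}hM].
rewrite nrm_amplification; have := nrm_coord (h n).
rewrite inner_basis_vec in hM.
have := nrmD (1 - coord (h n) false) (coord (h n) false); rewrite subrK nrm1.
have := nrmD (`|h n| - 1) 1; rewrite subrK nrm1 nrmE nrm_real ger0_norm ?nrm_ge0//.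
rewrite nrmC -[X in nrm (_ - X)]nrmE; move: hM hN.
set al := nrm (coord _ false); set be := nrm (coord _ true); set nu := nrm (h n).
set p := nrm (1 - coord _ _); set q := nrm (1 - _) => hM hN h3 h4 h5.
have nu0 : 0 <= nu by exact: nrm_ge0.
have : nu ^+ 2 <= (1 + d) ^+ 2 by rewrite ler_sqr ?nnegrE//; lra.
have : (1 - d) ^+ 2 <= al ^+ 2 by rewrite ler_sqr ?nnegrE ?nrm_ge0//; lra.
move=> h6 h7; have : be ^+ 2 <= (1 / 8) ^+ 2.
  by rewrite -dE; move: h5 h6 h7; rewrite !expr2; lra.
rewrite ler_sqr ?nnegrE ?nrm_ge0//; lra.
Qed.

Lemma amplified_vanishes (h : forall n, H n) : C0_class y h ->
  unconditional_prod (fun n => `|amplification (h n)|) 0.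
Proof.
move=> /amplification_C0_class[N hN]; apply: (@unconditional_prod_contract0 _ _ N) => n /hN.
by rewrite nrmE nrm_real ger0_norm ?nrm_ge0.
Qed.

Let flip k : forall n, H n := fun n => basis_vec (n < k)%N.

Lemma C0_class_flip k : C0_class y (flip k).
Proof.
by apply: (@C0_class_eventually _ _ _ _ _ k) C0_class_y => n kn; rewrite /flip ltnNge kn.
Qed.

Variable T : complete_tensor H.
Let W := incomplete_tensor T y.

(** For j <> k some factor vanishes: at the smaller of j and k there is
    either A e_0 = 0 or a pairing of e_1 with e_0. *)
Lemma inner_partial_flip (F : {fset nat}) (B : T -> T) j k :
  partial_operator T (fun=> amplification) y F B ->
  (forall n, (n \in F) = (n < k)%N) ->
  inner T (B (tensor T (flip j))) (tensor T (flip k)) = if j == k then 4 ^+ k else 0.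
Proof.
move=> [_ BE] Fk; rewrite BE; last exact: C0_class_flip.
set h := fun n => _.
have yh : C0_class y h.
  apply: (@C0_class_eventually _ _ _ _ _ k) (C0_class_flip j) => n; rewrite /h Fk.
  by rewrite leqNgt => /negPf ->.
rewrite tensor_inner; [|exact: C0_class_C_sequence yh|exact: C0_class_C_sequence (C0_class_flip k)].
have ip n : inner_seq h (flip k) n = if (n < k)%N then (if (n < j)%N then 4 else 0)
    else (if (n < j)%N then 0 else 1).
  rewrite /inner_seq inner_basis_vec /h Fk; case: ifP => _.
    by rewrite amplification_basis_vec; case: ifP => _; rewrite ?coord_scale ?coord_vec ?mulr1.
  by rewrite coord_vec; case: (n < j)%N.
rewrite (@qprod_eventually1 _ _ (maxn j k)); last first.
  by move=> n; rewrite geq_max ip => /andP[jn kn]; rewrite !ltnNge jn kn.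
case: (ltngtP j k) => [jk|kj|jk].
- rewrite (bigD1_seq j) ?iota_uniq ?mem_index_iota//=.
  by rewrite ip jk ltnn mul0r.
- rewrite (bigD1_seq k) ?iota_uniq ?mem_index_iota//=.
  by rewrite ip kj ltnn mul0r.
- rewrite (eq_big_nat _ _ (F2 := fun=> 4)) => [|n /andP[_ nj]]; last by rewrite ip -{1}jk nj.
  by rewrite prodr_const_nat subn0 jk.
Qed.

Lemma nrm_flip k : nrm (tensor T (flip k)) = 1.
Proof.
have Cf := C0_class_C_sequence (C0_class_flip k).
apply/eqP; rewrite -(@eqrXn2 _ 2) ?nrm_ge0// expr1n; apply/eqP/(@complexI R).
rewrite -inner_self tensor_inner// (@qprod_eventually1 _ _ 0) ?big_geq// => n _.
by rewrite /inner_seq inner_self nrm_basis_vec expr1n.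
Qed.

Let unbounding_series : exists x : T,
  \sum_(0 <= k < n) ((1 / 2) ^+ k)%:C%C *: tensor T (flip k) @[n --> \oo] --> x.
Proof.
apply: absolutely_cvg_series; apply: bounded_sums_le (@bounded_sums_half R) => n.
rewrite nrmZ nrm_flip mulr1 nrm_real ger0_norm// exprn_ge0//; lra.
Qed.

(** Over F = [0, k) the image of x has norm at least 2^k, while convergence
    would bound it for all large F. *)
Lemma strong_limit_fails : ~ strong_limit_well_defined T (fun=> amplification) y.
Proof.
move=> [L [_ strong]].
have [AF AFP] := choice (partial_operator_exists T y reflection_isometry amplificationE).
have [x Sx] := unbounding_series.
set S := fun n => \sum_(0 <= k < n) _ in Sx.
have WS n : W (S n).
  rewrite /S; apply: (@closure_lin_span_sub _ _ [set tensor T (flip k) | k in setT]).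
    by move=> _ [k _ <-]; exact/incomplete_tensor_gen/C0_class_flip.
  elim: n => [|n IH]; first by rewrite big_geq//; exact: lin_span0.
  rewrite big_nat_recr//= addrC; apply: lin_span_lincomb => //.
  by apply: lin_span_gen; exists n.
have Wx : W x.
  apply/closure_nrmP => e e0; have e2 : 0 < e / 2 by lra.
  have [N /(_ N (leqnn N)) hN] := (cvg_nrmP _ _).1 Sx _ e2.
  have /closure_nrmP/(_ _ e2)[z sz Sz] := WS N; exists z => //.
  by apply: le_lt_trans (nrm_tri _ (S N) _) _; rewrite nrmC [e]splitr ltrD.
(* It suffices to bound the images of the partial sums, whose t_k component
   is 2^-k * 4^k. *)
have lower (F : {fset nat}) k : (forall n, (n \in F) = (n < k)%N) -> 2 ^+ k <= nrm (AF F x).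
  move=> Fk; have [/bounded_operatorP[_ linB [M M0 BM]] _] := AFP F.
  have AF0 : AF F 0 = 0.
    have W0 : W 0 by apply/subset_closure/lin_span0.
    by have := linB (-1) 0 0 W0 W0; rewrite scaler0 addr0 scaleN1r addNr.
  have innerS n : inner T (AF F (S n)) (tensor T (flip k)) = if (k < n)%N then (2 ^+ k)%:C%C else 0.
    elim: n => [|n IH]; first by rewrite /S big_geq// AF0 linear0l.
    rewrite /S big_nat_recr//= addrC linB; [|exact/incomplete_tensor_gen/C0_class_flip|exact: WS].
    rewrite linearDl linearZl_LR /= IH (inner_partial_flip _ (AFP F) Fk) ltnS.
    case: (ltngtP n k) => [nk|nk|->].
    - by rewrite mulr0 add0r.
    - by rewrite mulr0 add0r.
    - rewrite addr0; have -> : (4 : C) = (4 : R)%:C%C by rewrite rmorph_nat.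
      by rewrite -rmorphXn -rmorphM /= -exprMn; congr ((_ ^+ _)%:C%C); lra.
  apply: le_eps => e e0; have d0 : 0 < e / (M + 1) by rewrite divr_gt0// ltr_wpDl.
  have [N hN] := (cvg_nrmP _ _).1 Sx _ d0; pose n := maxn N k.+1.
  have {hN}hN := hN n (leq_maxl _ _).
  have lowS : 2 ^+ k <= nrm (AF F (S n)).
    have := inner_cauchy_schwarz (AF F (S n)) (tensor T (flip k)).
    by rewrite innerS leq_maxr nrm_flip mulr1 nrm_real ger0_norm// exprn_ge0.
  have linD : AF F (S n - x) = AF F (S n) - AF F x.
    by have := linB (-1) x (S n) Wx (WS n); rewrite !scaleN1r !(addrC (- _)).
  have WD : W (S n - x).
    by have := closure_lin_span_lincomb (a := -1) Wx (WS n); rewrite scaleN1r addrC.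
  have := BM _ WD; rewrite linD => h1.
  have := nrmD (AF F (S n) - AF F x) (AF F x); rewrite subrK => h2.
  suff h3 : M * nrm (S n - x) <= e by move: lowS h1 h2 h3; lra.
  apply: (@le_trans _ _ ((M + 1) * (e / (M + 1)))).
    by apply: ler_pM; rewrite ?nrm_ge0 ?lerDl// ltW.
  by rewrite mulrC divfK// lt0r_neq0// ltr_wpDl.
have FT : ProperFilter (@totally nat) by exact: totally_filter.
have /cvgrPdist_lt/(_ 1 ltr01)[F0 _ hF0] := strong AF AFP x Wx.
pose k := maxn (\max_(i <- (F0 : seq nat)) i).+1 (Num.truncn (nrm (L x) + 1)).+1.
pose F := [fset n | n in iota 0 k]%fset.
have Fk n : (n \in F) = (n < k)%N by rewrite inE /= mem_iota.
have /hF0 : [set B | (F0 `<=` B)%fset] F.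
  apply/fsubsetP => i iF0; rewrite Fk leq_max ltnS; apply/orP; left.
  exact: leq_bigmax_seq.
rewrite /= nrmE ltcR => LF.
have upper : nrm (AF F x) <= nrm (L x) + 1.
  rewrite -[in leLHS](subrK (L x) (AF F x)); apply: le_trans (nrmD _ _) _.
  by rewrite addrC lerD2l nrmC ltW.
have : nrm (L x) + 1 < 2 ^+ k.
  apply: lt_trans (truncnS_gt _) _.
  apply: (@le_lt_trans _ _ (k%:R)); first by rewrite ler_nat leq_maxr.
  by rewrite -natrX ltr_nat ltn_expl.
by move=> /lt_le_trans/(_ (le_trans (lower F k Fk) upper)); rewrite ltxx.
Qed.

Lemma factorwise_zero : factorwise_tensor T (fun=> amplification) y (fun=> 0).
Proof.
have W0 : W 0 by apply/subset_closure/lin_span0.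
have Camp h : C0_class y h -> C_sequence (fun n => amplification (h n) : H n).
  by move=> yh; exists 0; exact: amplified_vanishes.
have t0 h : C0_class y h -> tensor T (fun n => amplification (h n) : H n) = 0.
  move=> yh; apply: nrm_eq0; apply/eqP; rewrite -sqrf_eq0; apply/eqP/(@complexI R).
  rewrite -inner_self tensor_inner; [|exact: Camp|exact: Camp].
  apply: qprodE; apply: unconditional_prod_dominated0
    (amplified_vanishes yh) (amplified_vanishes yh) => n.
  rewrite /inner_seq !nrmE !nrm_real !ger0_norm ?nrm_ge0//.
  exact: inner_cauchy_schwarz.
split.
- exact: Camp.
- by move=> h /t0 ->.
- apply/bounded_operatorP; split => //; first by move=> a u v _ _; rewrite scaler0 addr0.
  by exists 0 => // u _; rewrite nrm0 mul0r.
- by move=> h /t0 ->.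
Qed.

Lemma complete_tensor_fails : ~ complete_well_defined T (fun=> amplification).
Proof.
move=> [B [CA _ _ _]].
have Ch : @C_sequence _ H (fun=> basis_vec true).
  suff /C0_sequenceP[] : bounded_sums (fun n => nrm (1 - `|(fun=> basis_vec true : E) n|)) by [].
  apply: (@bounded_sums_eventually0 _ _ 0%N) => n _.
  by rewrite nrmE nrm_basis_vec subrr nrm0.
have [a /unconditional_prod_cvg/cvg_nrmP/(_ _ ltr01)[N hN]] := CA _ Ch.
have prodE n : \prod_(0 <= k < n) `|amplification (basis_vec true)| = (4 ^+ n)%:C%C.
  rewrite prodr_const_nat subn0 nrmE nrm_amplification coord_vec nrm1 mulr1.
  by rewrite rmorphXn.
have := hN N (leqnn N); have := hN N.+1 (leqnSn N); rewrite !prodE => h1 h2.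
have := nrm_tri ((4 ^+ N.+1)%:C%C : C) a (4 ^+ N)%:C%C.
rewrite (nrmC a) -rmorphB nrm_real => h3.
have : 1 <= 4 ^+ N :> R by rewrite exprn_ege1// ler1n.
move: h3 (exprS (4 : R) N) => /(le_trans (ler_norm _)); move: h1 h2; lra.
Qed.

End Example.

Theorem proposition6p5 (R : realType) :
  exists (H : nat -> hilbert R[i]) (A : forall n, H n -> H n)
         (y : forall n, H n),
    [/\ forall n, bounded_operator setT (A n),
        C0_sequence y,
        inhabited (complete_tensor H)
      & forall T : complete_tensor H,
          [/\ factorwise_tensor T A y (fun=> 0),
              ~ strong_limit_well_defined T A y
            & ~ complete_well_defined T A]].
Proof.
exists (fun=> l2 R bool), (fun=> @amplification R), (fun=> basis_vec R false).
split.
- by move=> n; exact: amplification_bounded.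
- exact: C0_sequence_y.
- exact: (@complete_tensor_exists R (fun=> bool)).
- move=> T; split; [exact: factorwise_zero|exact: strong_limit_fails|exact: complete_tensor_fails].
Qed.
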